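(* Let $t_0\in\mathbb{R}$ and let $c_0\in M_n$ be strictly positive (Hermitian with strictly positive eigenvalues). Then the noncommutative Ricci flow equation $\frac{d}{dt}c(t)=-\triangle\log c(t)$ with $c(t_0)=c_0$ has a unique solution $c$ on $[t_0,\infty)$ consisting of strictly positive matrices. Moreover $\tau(c(t))=\tau(c_0)$ for all $t\ge t_0$, and $\lim_{t\to\infty}c(t)=c_\infty 1$ (in any norm on $M_n$), where $c_\infty=\frac1n\tau(c_0)$. Finally, $\det c(t)$ is strictly increasing in $t$, unless $c_0=c_\infty 1$, in which case $c(t)=c_0$ for all $t$.
   Context: Let $n\ge 2$, let $m\in\{1,\dots,n-1\}$ be relatively prime to $n$, and set $q=e^{2\pi i m/n}$. Let $M_n$ be the algebra of complex $n\times n$ matrices with identity $1$. Let $u=\mathrm{diag}(1,q,\dots,q^{n-1})$ and let $v$ be the cyclic shift matrix with $v_{j,j+1}=1$ for $j=1,\dots,n-1$, $v_{n,1}=1$, other entries $0$. Let $x,y$ be any Hermitian matrices with $u=e^{\frac{2\pi i}{n}x}$ and $v=e^{\frac{2\pi i}{n}y}$. Define $\delta_1(a)=[y,a]$, $\delta_2(a)=-[x,a]$ and $\triangle=\delta_1^2+\delta_2^2$ on $M_n$. $\tau$ is the usual trace. For strictly positive $c$, $\log c$ is defined by functional calculus (diagonalize unitarily and take $\log$ of the eigenvalues). The time derivative is taken entrywise (equivalently in any norm). *)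

(* Defs.v *)
From HB Require Import structures.
From Stdlib Require Import Reals Lra ClassicalEpsilon FunctionalExtensionality.
From mathcomp Require Import all_boot all_order all_algebra all_fingroup.

Set Implicit Arguments.
Unset Strict Implicit.
Unset Printing Implicit Defensive.

Definition Reqb (x y : R) : bool := if Req_EM_T x y then true else false.
Lemma ReqbP : Equality.axiom Reqb.
Proof. move=> x y; rewrite /Reqb; case: Req_EM_T => h; by constructor. Qed.
HB.instance Definition _ := hasDecEq.Build R ReqbP.

Definition Rfind (P : pred R) (k : nat) : option R :=
  match excluded_middle_informative (exists x, P x) with
  | left h => Some (proj1_sig (constructive_indefinite_description _ h))
  | right _ => None
  end.
Lemma Rfind_some P k x : Rfind P k = Some x -> P x.
Proof.
rewrite /Rfind; case: excluded_middle_informative => // h [<-].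
exact: (proj2_sig (constructive_indefinite_description _ h)).
Qed.
Lemma Rfind_ex (P : pred R) : (exists x, P x) -> exists k, Rfind P k.
Proof. by move=> h; exists 0%N; rewrite /Rfind; case: excluded_middle_informative. Qed.
Lemma Rfind_ext (P Q : pred R) : P =1 Q -> Rfind P =1 Rfind Q.
Proof. by move=> /functional_extensionality ->. Qed.
HB.instance Definition _ := hasChoice.Build R Rfind_some Rfind_ex Rfind_ext.

Record cpx := Cpx { Re : R; Im : R }.
Definition cpx2p (z : cpx) : R * R := (Re z, Im z).
Definition p2cpx (p : R * R) : cpx := Cpx p.1 p.2.
Lemma cpx2pK : cancel cpx2p p2cpx. Proof. by case. Qed.
HB.instance Definition _ := Choice.copy cpx (can_type cpx2pK).

Local Open Scope R_scope.
Definition C0 := Cpx 0 0.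
Definition C1 := Cpx 1 0.
Definition Cadd (z w : cpx) := Cpx (Re z + Re w) (Im z + Im w).
Definition Copp (z : cpx) := Cpx (- Re z) (- Im z).
Definition Cmul (z w : cpx) :=
  Cpx (Re z * Re w - Im z * Im w) (Re z * Im w + Im z * Re w).
Definition Cconj (z : cpx) := Cpx (Re z) (- Im z).
Definition RtoC (r : R) := Cpx r 0.
Definition Cexpi (theta : R) := Cpx (cos theta) (sin theta).

Lemma cpx_eq (z w : cpx) : Re z = Re w -> Im z = Im w -> z = w.
Proof. by case: z; case: w => /= ? ? ? ? -> ->. Qed.

Lemma CaddA : associative Cadd.
Proof. by move=> ? ? ?; apply: cpx_eq => /=; ring. Qed.
Lemma CaddC : commutative Cadd.
Proof. by move=> ? ?; apply: cpx_eq => /=; ring. Qed.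
Lemma Cadd0 : left_id C0 Cadd.
Proof. by move=> ?; apply: cpx_eq => /=; ring. Qed.
Lemma CaddN : left_inverse C0 Copp Cadd.
Proof. by move=> ?; apply: cpx_eq => /=; ring. Qed.
HB.instance Definition _ := GRing.isZmodule.Build cpx CaddA CaddC Cadd0 CaddN.

Lemma CmulA : associative Cmul.
Proof. by move=> ? ? ?; apply: cpx_eq => /=; ring. Qed.
Lemma CmulC : commutative Cmul.
Proof. by move=> ? ?; apply: cpx_eq => /=; ring. Qed.
Lemma Cmul1 : left_id C1 Cmul.
Proof. by move=> ?; apply: cpx_eq => /=; ring. Qed.
Lemma CmulDl : left_distributive Cmul Cadd.
Proof. by move=> ? ? ?; apply: cpx_eq => /=; ring. Qed.
Lemma C1_neq0 : C1 != C0.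
Proof. by apply/eqP => -[]; apply: R1_neq_R0. Qed.
HB.instance Definition _ :=
  GRing.Zmodule_isComNzRing.Build cpx CmulA CmulC Cmul1 CmulDl C1_neq0.
Local Close Scope R_scope.

Import GRing.Theory.
Local Open Scope ring_scope.

Definition adjoint n (A : 'M[cpx]_n) : 'M[cpx]_n := map_mx Cconj A^T.
Definition is_hermitian n (A : 'M[cpx]_n) : Prop := adjoint A = A.
Definition is_unitary n (U : 'M[cpx]_n) : Prop := adjoint U *m U = 1%:M.

Definition strictly_pos n (c : 'M[cpx]_n) : Prop :=
  is_hermitian c /\
  forall (lam : cpx) (v : 'cV[cpx]_n), v != 0 -> c *m v = lam *: v ->
    Im lam = R0 /\ Rlt R0 (Re lam).

Definition is_log n (c L : 'M[cpx]_n) : Prop :=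
  exists (U : 'M[cpx]_n) (d : 'I_n -> R),
    is_unitary U /\ (forall i, Rlt R0 (d i)) /\
    c = U *m diag_mx (\row_i RtoC (d i)) *m adjoint U /\
    L = U *m diag_mx (\row_i RtoC (ln (d i))) *m adjoint U.

Definition mpow n (A : 'M[cpx]_n) (k : nat) : 'M[cpx]_n := iter k (mulmx A) 1%:M.
Definition exp_partial n (A : 'M[cpx]_n) (N : nat) : 'M[cpx]_n :=
  \sum_(k < N.+1) RtoC (Rinv (INR (k`!)%N)) *: mpow A k.
Definition is_mexp n (A E : 'M[cpx]_n) : Prop :=
  forall i j, Un_cv (fun N => Re (exp_partial A N i j)) (Re (E i j)) /\
              Un_cv (fun N => Im (exp_partial A N i j)) (Im (E i j)).

Definition qroot (n m : nat) : cpx := Cexpi (Rdiv (Rmult (Rmult 2 PI) (INR m)) (INR n)).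
Definition umat (n m : nat) : 'M[cpx]_n := diag_mx (\row_(j < n) qroot n m ^+ j).
Definition vmat (n : nat) : 'M[cpx]_n :=
  \matrix_(i < n, j < n) (if (j == (i.+1 %% n)%N :> nat) then 1 else 0).

Definition mcomm n (a b : 'M[cpx]_n) : 'M[cpx]_n := a *m b - b *m a.
Definition delta1 n (x y a : 'M[cpx]_n) : 'M[cpx]_n := mcomm y a.
Definition delta2 n (x y a : 'M[cpx]_n) : 'M[cpx]_n := - mcomm x a.
Definition lap n (x y a : 'M[cpx]_n) : 'M[cpx]_n :=
  delta1 x y (delta1 x y a) + delta2 x y (delta2 x y a).

(* entrywise derivative of c at t, taken within the domain [t0, +oo)
   (one-sided at t = t0) *)
Definition deriv_within n (t0 : R) (c : R -> 'M[cpx]_n) (t : R) (D : 'M[cpx]_n) : Prop :=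
  forall i j,
    limit1_in (fun s => Rdiv (Rminus (Re (c s i j)) (Re (c t i j))) (Rminus s t))
              (fun s => Rle t0 s /\ s <> t) (Re (D i j)) t /\
    limit1_in (fun s => Rdiv (Rminus (Im (c s i j)) (Im (c t i j))) (Rminus s t))
              (fun s => Rle t0 s /\ s <> t) (Im (D i j)) t.

Definition ricci_solution n (x y : 'M[cpx]_n) (t0 : R) (c0 : 'M[cpx]_n)
    (c : R -> 'M[cpx]_n) : Prop :=
  c t0 = c0 /\
  forall t, Rle t0 t ->
    strictly_pos (c t) /\
    forall L, is_log (c t) L -> deriv_within t0 c t (- lap x y L).

(* entrywise convergence (equivalent to convergence in any norm on M_n) *)
Definition mat_lim_infty n (c : R -> 'M[cpx]_n) (A : 'M[cpx]_n) : Prop :=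
  forall eps, Rlt R0 eps -> exists T, forall t, Rle T t -> forall i j,
    Rlt (Rabs (Rminus (Re (c t i j)) (Re (A i j)))) eps /\
    Rlt (Rabs (Rminus (Im (c t i j)) (Im (A i j)))) eps.

Definition two_pi_i_over (n : nat) : cpx :=
  Cpx R0 (Rdiv (Rmult (IZR 2) PI) (INR n)).
Definition c_infty n (c0 : 'M[cpx]_n) : cpx := RtoC (Rinv (INR n)) * \tr c0.

(* Main.v *)
(** For functions [f], [h] and [a = U diag(l) U^*], [b = W diag(m) W^*] one has
    [tr (f(a) y h(b) y^* ) = sum_ij |(U^* y W)_ij|^2 f(l_i) h(m_j)].  Hence a scalar
    Lipschitz function is Lipschitz, with the same constant, as a map on Hermitian
    matrices in the Hilbert-Schmidt norm, and the flow with [log] replaced by the logarithm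
    of a truncation to [lo, hi] is a globally Lipschitz, bounded ODE, solved by
    Picard iteration and unique forwards and backwards in time.

    For convex [phi], Klein's inequality gives
    [d/dt tr phi(c) = - tr (phi'(c) lap (log c))
       = - sum_ij (|x_ij|^2 + |y_ij|^2) (phi'(l_i) - phi'(l_j)) (log l_i - log l_j) <= 0],
    with [x], [y] written in an eigenbasis of [c].  With [phi(s) = max(lo - s, 0)^2] the
    eigenvalues stay above the initial minimum [lo]; the trace is conserved, so they stay
    below [hi = tr c0], the truncation is never active, and every solution of the original
    equation solves the truncated one.  With [phi(s) = (s - tr c0 / n)^2] and the
    spectral gap of the Laplacian (only scalars commute with [x] and [y], since they then
    commute with [u] and [v]) one gets exponential convergence.  With [phi = - log],
    [log det c] strictly increases unless [c(t)] is scalar, which by backward uniqueness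
    forces [c0] to be scalar. *)

From mathcomp Require Import Rstruct.
From Coquelicot Require Import Coquelicot.
From mathcomp Require Import all_boot all_order all_algebra.
From mathcomp Require Import spectral complex.
Require Import Defs.
From HB Require Import structures.
From Stdlib Require Import ZArith Reals Lra ClassicalEpsilon FunctionalExtensionality.
Set Implicit Arguments. Unset Strict Implicit. Unset Printing Implicit Defensive.
Import GRing.Theory.
Local Open Scope ring_scope.
Delimit Scope nat_scope with N.
Local Notation "\rsum_ i F" := (\big[Rplus/IZR 0]_i F%R)
  (at level 41, i name, F at level 41, format "\rsum_ i  F").

(** * Spectral theorem *)

Definition Cinv (z : cpx) : cpx :=
  let q := (Re z * Re z + Im z * Im z)%R in Cpx (Re z / q)%R (- Im z / q)%R.

Lemma CmulV (z : cpx) : z != 0 -> Cinv z * z = 1.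
Proof.
case: z => a b /eqP nz; have q0 : (a * a + b * b <> 0)%R.
  move=> q0; apply: nz; congr Cpx; nra.
by apply: cpx_eq => /=; field; lra.
Qed.
Lemma Cinv0 : Cinv 0 = 0.
Proof. by apply: cpx_eq; rewrite /= /Rdiv ?Ropp_0 Rmult_0_l. Qed.
HB.instance Definition _ := GRing.ComNzRing_isField.Build cpx CmulV Cinv0.

Lemma conj_is_additive : additive Cconj.
Proof. by move=> a b; apply: cpx_eq => /=; lra. Qed.
Lemma conj_is_multiplicative : monoid_morphism Cconj.
Proof. by split=> [|a b]; apply: cpx_eq => /=; lra. Qed.
HB.instance Definition _ := GRing.isAdditive.Build cpx cpx Cconj conj_is_additive.
HB.instance Definition _ := GRing.isMonoidMorphism.Build cpx cpx Cconj conj_is_multiplicative.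


(* The spectral theorem of MathComp is transported from [complex R]. *)
Definition cpx_of (z : complex R) : cpx := Cpx (complex.Re z) (complex.Im z).
Definition of_cpx (z : cpx) : complex R := Complex (Re z) (Im z).

Lemma cpx_ofK : cancel of_cpx cpx_of. Proof. by case. Qed.
Lemma of_cpxK : cancel cpx_of of_cpx. Proof. by case. Qed.
Lemma cpx_of_is_additive : additive cpx_of.
Proof. by move=> [a b] [c d]; apply: cpx_eq. Qed.
Lemma cpx_of_is_multiplicative : monoid_morphism cpx_of.
Proof. by split=> // -[a b] [c d]; apply: cpx_eq. Qed.
HB.instance Definition _ := GRing.isAdditive.Build (complex R) cpx cpx_of cpx_of_is_additive.
HB.instance Definition _ := GRing.isMonoidMorphism.Build (complex R) cpx cpx_of cpx_of_is_multiplicative.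

Lemma cpx_of_conj (z : complex R) : cpx_of (Num.conj z) = Cconj (cpx_of z).
Proof. by case: z. Qed.

Lemma adjointK n : involutive (@adjoint n).
Proof. by move=> A; apply/matrixP => i j; rewrite !mxE; apply: cpx_eq; rewrite /= ?Ropp_involutive. Qed.

Lemma adjointM n (A B : 'M[cpx]_n) : adjoint (A *m B) = adjoint B *m adjoint A.
Proof. by rewrite /adjoint trmx_mul map_mxM. Qed.

Theorem hermitian_spectral n (A : 'M[cpx]_n) : is_hermitian A ->
  exists U (d : 'I_n -> R), is_unitary U /\
    A = U *m diag_mx (\row_i RtoC (d i)) *m adjoint U.
Proof.
move=> hA; pose A' := map_mx of_cpx A.
have AE : A = map_mx cpx_of A'.
  by apply/matrixP => i j; rewrite !mxE cpx_ofK.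
have hA' : A' \is (@hermitianmx _ n false Num.conj).
  apply/is_hermitianmxP; rewrite expr0 scale1r; apply/matrixP => i j; rewrite !mxE.
  apply: (can_inj of_cpxK); rewrite cpx_of_conj !cpx_ofK.
  by move/matrixP: hA => /(_ i j); rewrite !mxE => ->.
have /orthomx_spectralP := hermitian_normalmx hA'.
have := hermitian_spectral_diag_real hA'.
have := spectral_unitarymx A'.
move: (spectralmx A') (spectral_diag A') => P sp uP rsp.
rewrite invmx_unitary // => A'E.
have adjP : map_mx cpx_of (map_mx Num.conj P^T) = adjoint (map_mx cpx_of P).
  by apply/matrixP => i j; rewrite !mxE cpx_of_conj.
(* [orthomx_spectralP] gives [invmx P *m diag_mx sp *m P], so the unitary of the statement is the
   adjoint of [P]. *)
exists (adjoint (map_mx cpx_of P)), (fun i => complex.Re (sp 0 i)); split.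
  rewrite /is_unitary adjointK -adjP -map_mxM.
  by move/unitarymxP: uP => ->; rewrite map_mx1.
rewrite AE A'E !map_mxM adjP adjointK; congr (_ *m _ *m _).
rewrite map_diag_mx; congr diag_mx; apply/rowP => i; rewrite !mxE.
move/mxOverP: rsp => /(_ 0 i) /Num.Theory.CrealP.
case: (sp 0 i) => a b /= /(congr1 (@complex.Im R)) /= b0; apply: cpx_eq => //=.
by change (- b = b)%R in b0; lra.
Qed.

(** * Traces in terms of eigenvalues *)

Section RealSums.
Local Open Scope R_scope.
Variable I : finType.
Implicit Types (F G : I -> R).

Lemma rsum_ge0 F : (forall i, 0 <= F i) -> 0 <= \rsum_i F i.
Proof. move=> F0; elim/big_ind: _ => //; [lra | move=> *; lra]. Qed.

Lemma rsum_le F G : (forall i, F i <= G i) -> \rsum_i F i <= \rsum_i G i.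
Proof. move=> FG; elim/big_ind2: _ => //; [lra | move=> *; lra]. Qed.

Lemma rsumM a F : \rsum_i (a * F i) = a * \rsum_i F i.
Proof. by rewrite big_distrr. Qed.

Lemma rsumD F G : \rsum_i (F i + G i) = \rsum_i F i + \rsum_i G i.
Proof. exact: big_split. Qed.

Lemma rsumB F G : \rsum_i (F i - G i) = \rsum_i F i - \rsum_i G i.
Proof. elim/big_rec3: _ => [|i x y z _ ->]; lra. Qed.

Lemma rsum_const a : \big[Rplus/0]_(i : I) a = INR #|I| * a.
Proof.
rewrite big_const; elim: #|I| => [|k IH]; first by rewrite /=; lra.
rewrite S_INR iterS IH; lra.
Qed.

Lemma rsum_term F i : (forall i, 0 <= F i) -> F i <= \rsum_j F j.
Proof.
move=> F0; rewrite (bigD1 i) //=.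
suff : 0 <= \big[Rplus/0]_(j | j != i) F j by lra.
elim/big_ind: _ => //; [lra | move=> *; lra].
Qed.

Lemma rsum_eq0 F : (forall i, 0 <= F i) -> \rsum_i F i <= 0 -> forall i, F i = 0.
Proof. by move=> F0 S0 i; have := rsum_term i F0; have := F0 i; lra. Qed.

Lemma rsum_abs F : Rabs (\rsum_i F i) <= \rsum_i Rabs (F i).
Proof.
elim/big_rec2: _ => [|i a b _ ab]; first by rewrite Rabs_R0; lra.
by have := Rabs_triang (F i) b; lra.
Qed.

(* Cauchy-Schwarz against the constant function 1 *)
Lemma rsum_sqr F : (\rsum_i F i) ^ 2 <= INR #|I| * \rsum_i (F i) ^ 2.
Proof.
(* Expanded, this double sum is twice the difference of the two sides. *)
have : 0 <= \rsum_i \rsum_j (F i - F j) ^ 2.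
  by apply: rsum_ge0 => i; apply: rsum_ge0 => j; apply: pow2_ge_0.
rewrite (eq_bigr (fun i => INR #|I| * (F i) ^ 2 + \rsum_j (F j) ^ 2 - 2 * (\rsum_j F j) * F i)).
  rewrite rsumB rsumD !rsumM rsum_const; lra.
move=> i _; rewrite (eq_bigr (fun j => (F i)^2 + (F j) ^ 2 - 2 * F i * F j)).
  rewrite rsumB rsumD rsumM rsum_const; lra.
by move=> j _; ring.
Qed.
End RealSums.

Lemma rsum_exch (I J : finType) (F : I -> J -> R) :
  \rsum_i \rsum_j F i j = \rsum_j \rsum_i F i j.
Proof. exact: exchange_big. Qed.

Lemma rsum2_ge0 (I J : finType) (F : I -> J -> R) :
  (forall i j, 0 <= F i j)%R -> (0 <= \rsum_i \rsum_j F i j)%R.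
Proof. by move=> F0; apply: rsum_ge0 => i; apply: rsum_ge0. Qed.

Lemma rsum2_eq0 (I J : finType) (F : I -> J -> R) :
  (forall i j, 0 <= F i j)%R -> (\rsum_i \rsum_j F i j <= 0)%R -> forall i j, F i j = R0.
Proof.
move=> F0 S0 i; apply: rsum_eq0 => [k|]; first exact: F0.
apply: Req_le; apply: (rsum_eq0 (F := fun i => \rsum_j F i j)) => // k.
exact: rsum_ge0.
Qed.

Lemma rsum2_le (I J : finType) (F G : I -> J -> R) :
  (forall i j, F i j <= G i j)%R -> (\rsum_i \rsum_j F i j <= \rsum_i \rsum_j G i j)%R.
Proof. by move=> FG; apply: rsum_le => i; apply: rsum_le. Qed.

Lemma rsum2M (I J : finType) a (F : I -> J -> R) :
  \rsum_i \rsum_j (a * F i j) = (a * \rsum_i \rsum_j F i j)%R.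
Proof. by rewrite -rsumM; apply: eq_bigr => i _; rewrite rsumM. Qed.

Lemma rsum2D (I J : finType) (F G : I -> J -> R) :
  \rsum_i \rsum_j (F i j + G i j) = (\rsum_i \rsum_j F i j + \rsum_i \rsum_j G i j)%R.
Proof. by rewrite -rsumD; apply: eq_bigr => i _; rewrite rsumD. Qed.

Lemma rsum2B (I J : finType) (F G : I -> J -> R) :
  \rsum_i \rsum_j (F i j - G i j) = (\rsum_i \rsum_j F i j - \rsum_i \rsum_j G i j)%R.
Proof. by rewrite -rsumB; apply: eq_bigr => i _; rewrite rsumB. Qed.

(** * Squared modulus, adjoints and commutators *)

Definition nsq (z : cpx) : R := (Re z * Re z + Im z * Im z)%R.

Lemma nsq_ge0 z : (0 <= nsq z)%R.
Proof. by rewrite /nsq; nra. Qed.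

Lemma nsq_eq0 z : nsq z = R0 -> z = 0.
Proof. rewrite /nsq => h; apply: cpx_eq => /=; nra. Qed.

Lemma ReD (z w : cpx) : Re (z + w) = (Re z + Re w)%R. Proof. by []. Qed.
Lemma ImD (z w : cpx) : Im (z + w) = (Im z + Im w)%R. Proof. by []. Qed.
Lemma ReN (z : cpx) : Re (- z) = (- Re z)%R. Proof. by []. Qed.
Lemma ImN (z : cpx) : Im (- z) = (- Im z)%R. Proof. by []. Qed.
Lemma ReB (z w : cpx) : Re (z - w) = (Re z - Re w)%R. Proof. by []. Qed.
Lemma ImB (z w : cpx) : Im (z - w) = (Im z - Im w)%R. Proof. by []. Qed.
Lemma ReM (z w : cpx) : Re (z * w) = (Re z * Re w - Im z * Im w)%R. Proof. by []. Qed.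
Lemma ImM (z w : cpx) : Im (z * w) = (Re z * Im w + Im z * Re w)%R. Proof. by []. Qed.

Lemma Re_sum (I : finType) (F : I -> cpx) : Re (\sum_i F i) = \rsum_i Re (F i).
Proof. exact: (big_morph Re ReD). Qed.
Lemma Im_sum (I : finType) (F : I -> cpx) : Im (\sum_i F i) = \rsum_i Im (F i).
Proof. exact: (big_morph Im ImD). Qed.
Lemma RtoC_sum (I : finType) (F : I -> R) : RtoC (\rsum_i F i) = \sum_i RtoC (F i).
Proof. by apply: cpx_eq; rewrite ?Re_sum ?Im_sum //= rsum_const Rmult_0_r. Qed.
Lemma RtoCM a b : RtoC (a * b)%R = RtoC a * RtoC b.
Proof. by apply: cpx_eq => /=; ring. Qed.
Lemma RtoCD a b : RtoC (a + b)%R = RtoC a + RtoC b.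
Proof. by apply: cpx_eq => /=; ring. Qed.
Lemma RtoC_inj : injective RtoC. Proof. by move=> a b []. Qed.
Lemma mulconj (z : cpx) : z * Cconj z = RtoC (nsq z).
Proof. by apply: cpx_eq; rewrite /= /nsq /=; ring. Qed.

Lemma adjointD n (A B : 'M[cpx]_n) : adjoint (A + B) = adjoint A + adjoint B.
Proof. by rewrite /adjoint linearD /= map_mxD. Qed.
Lemma adjointN n (A : 'M[cpx]_n) : adjoint (- A) = - adjoint A.
Proof. by rewrite /adjoint linearN /= map_mxN. Qed.
Lemma adjointB n (A B : 'M[cpx]_n) : adjoint (A - B) = adjoint A - adjoint B.
Proof. by rewrite adjointD adjointN. Qed.
Lemma adjoint1 n : adjoint (1%:M : 'M[cpx]_n) = 1%:M.
Proof. by rewrite /adjoint trmx1 map_mx1. Qed.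

Lemma hermitianD n (A B : 'M[cpx]_n) : is_hermitian A -> is_hermitian B -> is_hermitian (A + B).
Proof. by rewrite /is_hermitian adjointD => -> ->. Qed.
Lemma hermitianN n (A : 'M[cpx]_n) : is_hermitian A -> is_hermitian (- A).
Proof. by rewrite /is_hermitian adjointN => ->. Qed.
Lemma hermitianB n (A B : 'M[cpx]_n) : is_hermitian A -> is_hermitian B -> is_hermitian (A - B).
Proof. by move=> hA /hermitianN; apply: hermitianD. Qed.

Lemma lapE n (x y a : 'M[cpx]_n) :
  lap x y a = mcomm y (mcomm y a) + mcomm x (mcomm x a).
Proof. by rewrite /lap /delta1 /delta2 /mcomm mulmxN mulNmx -opprD opprK. Qed.

Lemma mcomm2E n (y a : 'M[cpx]_n) :
  mcomm y (mcomm y a) = y *m y *m a - y *m a *m y - (y *m a *m y - a *m y *m y).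
Proof. by rewrite /mcomm mulmxBr mulmxBl !mulmxA. Qed.

Lemma mcommNr n (y a : 'M[cpx]_n) : mcomm y (- a) = - mcomm y a.
Proof. by rewrite /mcomm mulmxN mulNmx -opprD. Qed.

Lemma adjoint_mcomm n (y a : 'M[cpx]_n) : is_hermitian y ->
  adjoint (mcomm y a) = - mcomm y (adjoint a).
Proof. by move=> hy; rewrite /mcomm adjointB !adjointM hy opprB. Qed.

Lemma hermitian_lap n (x y a : 'M[cpx]_n) :
  is_hermitian x -> is_hermitian y -> is_hermitian a -> is_hermitian (lap x y a).
Proof.
move=> hx hy ha; rewrite /is_hermitian lapE adjointD.
by rewrite !adjoint_mcomm // ha !mcommNr !opprK.
Qed.

Lemma mxtraceN n (A : 'M[cpx]_n) : \tr (- A) = - \tr A.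
Proof. exact: linearN. Qed.
Lemma mxtraceB n (A B : 'M[cpx]_n) : \tr (A - B) = \tr A - \tr B.
Proof. exact: linearB. Qed.

Lemma mxtrace_mcomm n (y a : 'M[cpx]_n) : \tr (mcomm y a) = 0.
Proof. by rewrite /mcomm linearB /= mxtrace_mulC subrr. Qed.

Lemma mxtrace_lap n (x y a : 'M[cpx]_n) : \tr (lap x y a) = 0.
Proof. by rewrite lapE linearD /= !mxtrace_mcomm addr0. Qed.

Definition rdiag n (f : 'I_n -> R) : 'M[cpx]_n := diag_mx (\row_i RtoC (f i)).
Definition spect n (U : 'M[cpx]_n) (f : 'I_n -> R) := U *m rdiag f *m adjoint U.
(** On Hermitian matrices this is the Hilbert-Schmidt inner product. *)
Definition ip n (A B : 'M[cpx]_n) : R := Re (\tr (A *m B)).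
Definition hs2 n (A : 'M[cpx]_n) : R := \rsum_i \rsum_j nsq (A i j).
(** Squared coefficients of [Y] between the columns of [U] and of [W]. For [Y = 1] and unitary [U],
    [W] they form a doubly stochastic matrix, by [overlap_row] and [overlapC]. *)
Definition overlap n (U Y W : 'M[cpx]_n) i j : R := nsq ((adjoint U *m Y *m W) i j).

Section Spect.
Variable n : nat.
Implicit Types (U W Y A B : 'M[cpx]_n) (f g h : 'I_n -> R).

Lemma rdiagM f g : rdiag f *m rdiag g = rdiag (fun i => f i * g i)%R.
Proof.
rewrite /rdiag mulmx_diag; congr diag_mx; apply/rowP => i; rewrite !mxE.
by rewrite RtoCM.
Qed.

Lemma rdiag1 : rdiag (fun=> R1) = 1%:M :> 'M[cpx]_n.
Proof. by rewrite -diag_const_mx; congr diag_mx; apply/rowP => i; rewrite !mxE. Qed.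

Lemma unitaryV U : is_unitary U -> U *m adjoint U = 1%:M.
Proof. exact: mulmx1C. Qed.

Lemma spectM U f g : is_unitary U ->
  spect U f *m spect U g = spect U (fun i => f i * g i)%R.
Proof.
move=> hU; rewrite /spect -rdiagM !mulmxA; congr (_ *m _ *m _).
by rewrite -!mulmxA hU mulmx1.
Qed.

Lemma spect1 U : is_unitary U -> spect U (fun=> R1) = 1%:M.
Proof. by move=> hU; rewrite /spect rdiag1 mulmx1 unitaryV. Qed.

Lemma hermitian_spect U f : is_hermitian (spect U f).
Proof.
rewrite /is_hermitian /spect !adjointM adjointK mulmxA; congr (_ *m _ *m _).
apply/matrixP => i j; rewrite !mxE eq_sym.
by case: eqP => [->|_]; apply: cpx_eq => //=; rewrite Ropp_0.
Qed.

Lemma hs2E A : hs2 A = Re (\tr (A *m adjoint A)).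
Proof.
rewrite /mxtrace Re_sum; apply: eq_bigr => i _; rewrite mxE Re_sum.
by apply: eq_bigr => j _; rewrite !mxE /nsq /=; ring.
Qed.

Lemma hs2_ip A : is_hermitian A -> hs2 A = ip A A.
Proof. by move=> hA; rewrite hs2E hA. Qed.

Lemma ipBl A B C : ip (A - B) C = (ip A C - ip B C)%R.
Proof. by rewrite /ip mulmxBl linearB. Qed.
Lemma ipBr A B C : ip A (B - C) = (ip A B - ip A C)%R.
Proof. by rewrite /ip mulmxBr linearB. Qed.
Lemma ipDr A B C : ip A (B + C) = (ip A B + ip A C)%R.
Proof. by rewrite /ip mulmxDr linearD. Qed.
Lemma ipNr A B : ip A (- B) = (- ip A B)%R.
Proof. by rewrite /ip mulmxN linearN. Qed.
Lemma ipC A B : ip A B = ip B A.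
Proof. by rewrite /ip mxtrace_mulC. Qed.

Lemma ip_spect U W Y f h :
  ip (spect U f) (Y *m spect W h *m adjoint Y) =
  \rsum_i \rsum_j (overlap U Y W i j * (f i * h j)).
Proof.
pose Z := adjoint U *m Y *m W.
have -> : ip (spect U f) (Y *m spect W h *m adjoint Y) =
          Re (\tr (rdiag f *m Z *m (rdiag h *m adjoint Z))).
  rewrite /ip /spect -[U *m _ *m _ *m _]mulmxA -[U *m _ *m _]mulmxA mxtrace_mulC.
  by rewrite /Z !adjointM adjointK !mulmxA.
rewrite /mxtrace Re_sum; apply: eq_bigr => i _.
rewrite !mul_diag_mx mxE Re_sum; apply: eq_bigr => j _.
by rewrite /overlap -/Z; clearbody Z; rewrite !mxE /nsq !(ReM, ImM) /=; ring.
Qed.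

Lemma ip_spect_same U W f h : is_unitary U -> is_unitary W ->
  ip (spect U f) (spect U h) = \rsum_i \rsum_j (overlap U 1%:M W i j * (f i * h i)).
Proof.
move=> hU hW; rewrite /ip spectM //.
have := ip_spect U W 1%:M (fun i => f i * h i)%R (fun=> R1).
rewrite /ip spect1 // mulmx1 adjoint1 !mulmx1 => ->.
by apply: eq_bigr => i _; apply: eq_bigr => j _; rewrite Rmult_1_r.
Qed.

Lemma overlapC U W i j : overlap U 1%:M W i j = overlap W 1%:M U j i.
Proof.
rewrite /overlap !mulmx1.
have -> : adjoint W *m U = adjoint (adjoint U *m W) by rewrite adjointM adjointK.
by rewrite /adjoint !mxE /nsq /=; ring.
Qed.

(** All four terms of the product are sums over the same nonnegative weights, so matrices with
    different eigenbases can be compared through the scalar differences [f i - f' j]. *)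
Lemma ip_spect_diff U W f f' h h' : is_unitary U -> is_unitary W ->
  ip (spect U f - spect W f') (spect U h - spect W h') =
  \rsum_i \rsum_j (overlap U 1%:M W i j * ((f i - f' j) * (h i - h' j))).
Proof.
move=> hU hW.
have E (k l : 'I_n -> R) : ip (spect U k) (spect W l) =
    \rsum_i \rsum_j (overlap U 1%:M W i j * (k i * l j)).
  by rewrite -ip_spect adjoint1 mulmx1 mul1mx.
have E' : ip (spect W f') (spect W h') =
    \rsum_i \rsum_j (overlap U 1%:M W i j * (f' j * h' j)).
  rewrite (ip_spect_same _ _ hW hU) rsum_exch; apply: eq_bigr => i _; apply: eq_bigr => j _.
  by rewrite overlapC.
rewrite ipBl !ipBr (ip_spect_same _ _ hU hW) E (ipC (spect W f')) E E' -!rsumB.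
apply: eq_bigr => i _; rewrite -!rsumB; apply: eq_bigr => j _; ring.
Qed.

(** The four terms of the double commutator are sums with weights symmetric in [i] and [j], and
    combine into a product of differences. *)
Lemma ip_spect_mcomm U Y f h : is_unitary U -> is_hermitian Y ->
  ip (spect U f) (mcomm Y (mcomm Y (spect U h))) =
  \rsum_i \rsum_j (overlap U Y U i j * ((f i - f j) * (h i - h j))).
Proof.
move=> hU hY; rewrite mcomm2E !ipBr.
have sym i j : overlap U Y U i j = overlap U Y U j i.
  rewrite /overlap; set Z := _ *m _ *m _.
  have hZ : adjoint Z = Z by rewrite !adjointM adjointK hY mulmxA.
  by rewrite -{1}hZ !mxE /nsq /=; ring.
have E (k l : 'I_n -> R) : ip (spect U k) (Y *m spect U l *m Y) =
    \rsum_i \rsum_j (overlap U Y U i j * (k i * l j)).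
  by rewrite -ip_spect hY.
have e1 : ip (spect U f) (Y *m Y *m spect U h) =
    \rsum_i \rsum_j (overlap U Y U i j * (f i * h i)).
  transitivity (ip (spect U (fun i => f i * h i)%R) (Y *m spect U (fun=> R1) *m Y)).
    have -> : spect U (fun i => f i * h i)%R = spect U h *m spect U f.
      rewrite spectM //; congr spect; apply: functional_extensionality => i; ring.
    rewrite spect1 // mulmx1 /ip (mulmxA (spect U f)) mxtrace_mulC.
    by congr (Re (\tr _)); exact: mulmxA.
  by rewrite E; apply: eq_bigr => i _; apply: eq_bigr => j _; ring.
have e2 : ip (spect U f) (spect U h *m Y *m Y) =
    \rsum_i \rsum_j (overlap U Y U i j * (f j * h j)).
  transitivity (ip (spect U (fun i => f i * h i)%R) (Y *m spect U (fun=> R1) *m Y)).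
    by rewrite spect1 // mulmx1 /ip -spectM // -!mulmxA.
  by rewrite E rsum_exch; apply: eq_bigr => i _; apply: eq_bigr => j _; rewrite sym; ring.
have e3 : ip (spect U f) (Y *m spect U h *m Y) =
    \rsum_i \rsum_j (overlap U Y U i j * (f j * h i)).
  by rewrite E rsum_exch; apply: eq_bigr => i _; apply: eq_bigr => j _; rewrite sym; ring.
rewrite {1}E e1 e2 e3 -!rsumB; apply: eq_bigr => i _; rewrite -!rsumB.
by apply: eq_bigr => j _; ring.
Qed.

Lemma hs2_mcomm Y A : is_hermitian Y -> is_hermitian A ->
  hs2 (mcomm Y A) = ip A (mcomm Y (mcomm Y A)).
Proof.
move=> hY hA; rewrite hs2E adjoint_mcomm // hA mulmxN mxtraceN ReN; set K := mcomm Y A.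
have -> : \tr (K *m K) = \tr (Y *m A *m K) - \tr (A *m Y *m K).
  by rewrite {1}/K /mcomm mulmxBl mxtraceB.
clearbody K; rewrite /ip /mcomm mulmxBr mxtraceB [A *m (K *m Y)]mulmxA.
by rewrite [\tr (A *m K *m Y)]mxtrace_mulC !mulmxA !ReB Ropp_minus_distr.
Qed.

Lemma hs2_ge0 A : (0 <= hs2 A)%R.
Proof. by apply: rsum_ge0 => i; apply: rsum_ge0 => j; apply: nsq_ge0. Qed.

Lemma hs2_eq0 A : (hs2 A <= 0)%R -> A = 0.
Proof.
move=> h; apply/matrixP => i j; rewrite mxE; apply: nsq_eq0.
by apply: (rsum2_eq0 (F := fun i j => nsq (A i j))) => // k l; apply: nsq_ge0.
Qed.

Lemma overlap_ge0 U Y W i j : (0 <= overlap U Y W i j)%R.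
Proof. exact: nsq_ge0. Qed.

(** Makes functional calculus independent of the diagonalization. The vanishing squared distance is
    a weighted sum of [(d i - e j) ^ 2], so a positive weight forces [d i = e j], hence
    [f (d i) = f (e j)]. *)
Lemma spect_unique U W d e (f : R -> R) : is_unitary U -> is_unitary W ->
  spect U d = spect W e -> spect U (fun i => f (d i)) = spect W (fun i => f (e i)).
Proof.
move=> hU hW E; apply/eqP; rewrite -subr_eq0; apply/eqP; apply: hs2_eq0.
rewrite hs2_ip; last by apply: hermitianB; apply: hermitian_spect.
rewrite ip_spect_diff //; apply: Req_le.
have Z i j : (overlap U 1%:M W i j * ((d i - e j) * (d i - e j)) = 0)%R.
  apply: (rsum2_eq0 (F := fun i j => overlap U 1%:M W i j * ((d i - e j) * (d i - e j)))%R).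
    by move=> k l; apply: Rmult_le_pos (overlap_ge0 _ _ _ _ _) (Rle_0_sqr _).
  by rewrite -ip_spect_diff // E subrr /ip mul0mx mxtrace0; apply: Rle_refl.
rewrite (eq_bigr (fun=> 0%R)) ?rsum_const; first lra.
move=> i _; rewrite (eq_bigr (fun=> 0%R)) ?rsum_const; first lra.
move=> j _; have /Rmult_integral [-> | z] := Z i j; first lra.
have -> : d i = e j by nra.
lra.
Qed.

Lemma overlap_row U W i : is_unitary U -> is_unitary W ->
  \rsum_j overlap U 1%:M W i j = 1%R.
Proof.
move=> hU hW; rewrite /overlap mulmx1; set Z := _ *m _.
have /matrixP /(_ i i) : Z *m adjoint Z = 1%:M.
  by rewrite /Z adjointM adjointK mulmxA -[_ *m W *m _]mulmxA unitaryV // mulmx1.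
clearbody Z; rewrite !mxE eqxx => /(congr1 Re); rewrite Re_sum /= => <-.
by apply: eq_bigr => j _; rewrite !mxE /nsq /=; ring.
Qed.

(** Averages the scalar tangent-line inequality at the pairs [d i], [e j] over the doubly stochastic
    overlaps. *)
Lemma klein U W d e (f g : R -> R) : is_unitary U -> is_unitary W ->
  (forall a b, g a * (b - a) <= f b - f a)%R ->
  (ip (spect U (fun i => g (d i))) (spect W e - spect U d) <=
   \rsum_i f (e i) - \rsum_i f (d i))%R.
Proof.
move=> hU hW fg.
have := ip_spect U W 1%:M (fun i => g (d i)) e.
rewrite adjoint1 mulmx1 mul1mx ipBr (ip_spect_same _ _ hU hW) => ->.
have -> : \rsum_i f (e i) = \rsum_i \rsum_j (overlap U 1%:M W i j * f (e j)).
  rewrite rsum_exch; apply: eq_bigr => j _.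
  under eq_bigr => i _ do rewrite overlapC Rmult_comm.
  by rewrite rsumM overlap_row // Rmult_1_r.
have -> : \rsum_i f (d i) = \rsum_i \rsum_j (overlap U 1%:M W i j * f (d i)).
  apply: eq_bigr => j _; under eq_bigr => i _ do rewrite Rmult_comm.
  by rewrite rsumM overlap_row // Rmult_1_r.
rewrite -!rsum2B; apply: rsum2_le => i j.
have := Rmult_le_compat_l _ _ _ (overlap_ge0 U 1%:M W i j) (fg (d i) (e j)); lra.
Qed.
End Spect.

(** * Ordinary differential equations *)

Section RealAnalysis.
Local Open Scope R_scope.

Lemma is_derive_rsum (I : finType) (f : I -> R -> R) (df : I -> R) t :
  (forall i, is_derive (f i) t (df i)) ->
  is_derive (fun s => \rsum_i f i s) t (\rsum_i df i).
Proof.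
move=> fd; rewrite -big_enum.
apply: (is_derive_ext (fun s => \big[Rplus/IZR 0]_(i <- enum I) f i s)).
  by move=> s; rewrite big_enum.
elim: (enum I) => [|a l IH].
  by rewrite big_nil; apply: (is_derive_ext (fun=> 0)) => [s|]; [rewrite big_nil | apply: is_derive_const].
rewrite big_cons; apply: (is_derive_ext (fun s => f a s + \big[Rplus/IZR 0]_(i <- l) f i s)).
  by move=> s; rewrite big_cons.
exact: is_derive_plus.
Qed.

Lemma is_derive_continuity_pt f t (l : R) : is_derive f t l -> continuity_pt f t.
Proof.
move=> fd; apply/continuity_pt_filterlim; apply: ex_derive_continuous.
by exists l.
Qed.

Lemma mean_value (f df : R -> R) t0 s t : (forall r, t0 <= r -> is_derive f r (df r)) ->
  t0 <= s -> s < t -> exists c, s <= c <= t /\ f t - f s = df c * (t - s).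
Proof.
move=> fd s0 st.
have [||c [cst E]] := @MVT_gen f s t df; rewrite ?Rmin_left ?Rmax_right; try lra.
- by move=> x xst; apply: fd; lra.
- by move=> x xst; apply: is_derive_continuity_pt (fd x _); lra.
by exists c; move: cst; rewrite ?Rmin_left ?Rmax_right; lra.
Qed.

Lemma derive_ge0_incr (f df : R -> R) t0 : (forall t, t0 <= t -> is_derive f t (df t)) ->
  (forall t, t0 <= t -> 0 <= df t) -> forall s t, t0 <= s -> s <= t -> f s <= f t.
Proof.
move=> fd df0 s t s0 [st|<-]; last lra.
have [c [cst E]] := mean_value fd s0 st.
have := df0 c; nra.
Qed.

Lemma derive_gt0_incr (f df : R -> R) t0 : (forall t, t0 <= t -> is_derive f t (df t)) ->
  (forall t, t0 <= t -> 0 < df t) -> forall s t, t0 <= s -> s < t -> f s < f t.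
Proof.
move=> fd df0 s t s0 st.
have [c [cst E]] := mean_value fd s0 st.
have := df0 c; nra.
Qed.

Lemma derive_eq0_const (f : R -> R) t0 : (forall t, t0 <= t -> is_derive f t 0) ->
  forall t, t0 <= t -> f t = f t0.
Proof.
move=> fd t [st|<- //]; have [c [cst E]] := mean_value fd (Rle_refl t0) st; lra.
Qed.

Lemma is_derive_expl c k t0 t :
  is_derive (fun s => c * exp (k * (s - t0))) t (c * (k * exp (k * (t - t0)))).
Proof. by auto_derive => //; rewrite /Rminus; ring. Qed.

(** Adding [h] to, or subtracting it from, [C / k * exp (k * (t - t0))] gives a nondecreasing
    function that starts at [C / k >= 0]. The gain [/ k] is what makes Picard iteration contract. *)
Lemma derive_exp_bound (h dh : R -> R) t0 C k : 0 < k -> h t0 = 0 ->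
  (forall t, t0 <= t -> is_derive h t (dh t)) ->
  (forall t, t0 <= t -> Rabs (dh t) <= C * exp (k * (t - t0))) ->
  forall t, t0 <= t -> Rabs (h t) <= C / k * exp (k * (t - t0)).
Proof.
move=> k0 h0 hd hb t tt.
have C0 : 0 <= C / k.
  have := hb t0 (Rle_refl _); have := Rabs_pos (dh t0).
  rewrite Rminus_diag Rmult_0_r exp_0 => *; apply: Rdiv_le_0_compat; lra.
have e0 : exp (k * (t0 - t0)) = 1 by rewrite Rminus_diag Rmult_0_r exp_0.
apply: Rabs_le; split.
  have := @derive_ge0_incr (fun s => h s + C / k * exp (k * (s - t0)))
     (fun s => dh s + C / k * (k * exp (k * (s - t0)))) t0 _ _ t0 t (Rle_refl _) tt.
  rewrite h0 e0 => H; suff : 0 + C / k * 1 <= h t + C / k * exp (k * (t - t0)) by lra.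
  apply: H => s ss.
    by apply: (is_derive_plus h (fun s => C / k * exp (k * (s - t0)))); [exact: hd | exact: is_derive_expl].
  have := hb s ss => /Rabs_le_between.
  have -> : C / k * (k * exp (k * (s - t0))) = C * exp (k * (s - t0)) by field; lra.
  lra.
have := @derive_ge0_incr (fun s => C / k * exp (k * (s - t0)) - h s)
     (fun s => C / k * (k * exp (k * (s - t0))) - dh s) t0 _ _ t0 t (Rle_refl _) tt.
rewrite h0 e0 => H; suff : C / k * 1 - 0 <= C / k * exp (k * (t - t0)) - h t by lra.
apply: H => s ss.
  by apply: (is_derive_minus (fun s => C / k * exp (k * (s - t0))) h); [exact: is_derive_expl | exact: hd].
have := hb s ss => /Rabs_le_between.
have -> : C / k * (k * exp (k * (s - t0))) = C * exp (k * (s - t0)) by field; lra.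
lra.
Qed.

Lemma lipschitz_continuous (f : R -> R) L t : (forall s, Rabs (f s - f t) <= L * Rabs (s - t)) ->
  continuous f t.
Proof.
move=> fL; apply/continuity_pt_filterlim => eps eps0.
have L0 : 0 < Rabs L + 1 by have := Rabs_pos L; lra.
exists (eps / (Rabs L + 1)); split; first exact: Rdiv_lt_0_compat.
move=> s [_]; rewrite /dist /= /R_dist => st.
apply: Rle_lt_trans (fL s) _.
have : (Rabs L + 1) * Rabs (s - t) < eps.
  have -> : eps = (Rabs L + 1) * (eps / (Rabs L + 1)) by field; lra.
  exact: Rmult_lt_compat_l.
have := Rabs_pos (s - t); have := Rle_abs L; nra.
Qed.

Lemma Rmax_lipschitz s t a : Rabs (Rmax s a - Rmax t a) <= Rabs (s - t).
Proof.
rewrite /Rmax; case: (Rle_dec s a) => sa; case: (Rle_dec t a) => ta;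
  rewrite ?Rminus_diag ?Rabs_R0; try exact: Rabs_pos; try lra;
  by apply: Rabs_le; have := Rle_abs (s - t); have := Rle_abs (t - s); rewrite Rabs_minus_sym; lra.
Qed.
End RealAnalysis.

(** * Global solutions by Picard iteration *)

Section Picard.
Local Open Scope R_scope.
Variables (I : finType) (F : (I -> R) -> I -> R) (K B : R).
Hypothesis K0 : 0 <= K.
Hypothesis F_lip : forall u v i, Rabs (F u i - F v i) <= K * \rsum_j Rabs (u j - v j).
Hypothesis F_bound : forall u i, Rabs (F u i) <= B.
Variables (t0 : R) (u0 : I -> R).

Let N := INR #|I|.
(** Rate of the weight [exp (k * (t - t0))]: a Picard step multiplies weighted distances by
    [K * N / k <= / 2]. The [+ 1] keeps [k] positive when [K * N = 0]. *)
Let k := 2 * (K * N) + 1.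

Let N0 : 0 <= N. Proof. exact: pos_INR. Qed.
Let KN0 : 0 <= K * N. Proof. exact: Rmult_le_pos. Qed.
Let k0 : 0 < k. Proof. by rewrite /k; lra. Qed.

Lemma F_close u v i e : (forall j, Rabs (u j - v j) <= e) -> Rabs (F u i - F v i) <= K * N * e.
Proof.
move=> uv; apply: Rle_trans (F_lip _ _ _) _; rewrite Rmult_assoc.
by apply: Rmult_le_compat_l => //; rewrite /N -rsum_const; apply: rsum_le.
Qed.

(** Left of [t0] the argument is frozen at [w t0], so for Lipschitz [w] the result is differentiable
    on the whole line, in particular at [t0]. *)
Let step (w : R -> I -> R) (t : R) (i : I) : R :=
  u0 i + RInt (fun s => F (w (Rmax s t0)) i) t0 t.
Let lip (w : R -> I -> R) := forall s t i, Rabs (w s i - w t i) <= B * Rabs (s - t).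

Lemma step_t0 w i : step w t0 i = u0 i.
Proof. by rewrite /step RInt_point /zero /=; lra. Qed.

Lemma step_derive w i t : lip w ->
  is_derive (fun s => step w s i) t (F (w (Rmax t t0)) i).
Proof.
move=> wl; rewrite -[X in is_derive _ _ X]Rplus_0_l.
apply: (is_derive_plus (fun=> u0 i) (fun r => RInt (fun s => F (w (Rmax s t0)) i) t0 r));
  first exact: is_derive_const.
have cont s : continuous (fun s => F (w (Rmax s t0)) i) s.
  apply: (@lipschitz_continuous _ (K * N * B)) => r; rewrite Rmult_assoc.
  apply: F_close => j; apply: Rle_trans (wl _ _ _) _; apply: Rmult_le_compat_l.
    by have := F_bound u0 i; have := Rabs_pos (F u0 i); lra.
  exact: Rmax_lipschitz.
apply: (is_derive_RInt (fun s => F (w (Rmax s t0)) i) _ t0); last exact: cont.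
apply: filter_forall => s; apply: (@RInt_correct R_CompleteNormedModule).
by apply: ex_RInt_continuous => r _; exact: cont.
Qed.

Lemma step_lip w : lip w -> lip (step w).
Proof.
move=> wl s t i; rewrite Rabs_minus_sym (Rabs_minus_sym s).
apply: (bounded_variation (fun r => step w r i) (fun r => F (w (Rmax r t0)) i)) => r _.
by split; [exact: step_derive | exact: F_bound].
Qed.

Let u (m : nat) : R -> I -> R := ssrnat.iter m step (fun=> u0).

Lemma u_lip m : lip (u m).
Proof.
elim: m => [|m IH] /=; last exact: step_lip.
move=> s t i; rewrite Rminus_diag Rabs_R0; apply: Rmult_le_pos (Rabs_pos _).
by have := F_bound u0 i; have := Rabs_pos (F u0 i); lra.
Qed.

Lemma step_close w v C t i : lip w -> lip v -> 
  (forall s j, t0 <= s -> Rabs (w s j - v s j) <= C * exp (k * (s - t0))) ->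
  t0 <= t -> Rabs (step w t i - step v t i) <= C / 2 * exp (k * (t - t0)).
Proof.
move=> wl vl wv tt.
have C0 : 0 <= C.
  have := wv t0 i (Rle_refl _); have := Rabs_pos (w t0 i - v t0 i).
  by rewrite Rminus_diag Rmult_0_r exp_0; lra.
apply: Rle_trans (_ : K * N * C / k * exp (k * (t - t0)) <= _).
  apply: (@derive_exp_bound (fun t => step w t i - step v t i)
    (fun t => F (w (Rmax t t0)) i - F (v (Rmax t t0)) i)) => //.
  - by rewrite !step_t0; lra.
  - by move=> s _; apply: (is_derive_minus (fun t => step w t i)); exact: step_derive.
  move=> s ss; rewrite Rmax_left // Rmult_assoc; apply: F_close => j; exact: wv.
apply: Rmult_le_compat_r; first exact/Rlt_le/exp_pos.
apply/Rle_div_l => //; rewrite /k; nra.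
Qed.

Lemma u_step m t i : t0 <= t ->
  Rabs (u m.+1 t i - u m t i) <= B / k * (/ 2) ^ m * exp (k * (t - t0)).
Proof.
elim: m t i => [|m IH] t i tt; last first.
  have -> : B / k * (/ 2) ^ m.+1 = B / k * (/ 2) ^ m / 2 by rewrite /=; lra.
  apply: step_close (u_lip m.+1) (u_lip m) _ tt => s j ss; exact: IH.
rewrite /= Rmult_1_r.
have B0 : 0 <= B by have := F_bound u0 i; have := Rabs_pos (F u0 i); lra.
apply: (@derive_exp_bound (fun t => step (u 0) t i - u0 i)
    (fun t => F (u 0 (Rmax t t0)) i)) => //.
- by rewrite step_t0; lra.
- move=> s _; rewrite -[X in is_derive _ _ X]Rminus_0_r.
  apply: (is_derive_minus (fun t => step (u 0) t i)); last exact: is_derive_const.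
  by apply: step_derive; exact: (u_lip 0).
(* First iterate: the derivative is at most [B], hence at most [B] times the weight, which
   integrates to the factor [B / k]. *)
move=> s ss; apply: Rle_trans (F_bound _ _) _.
rewrite -{1}[B]Rmult_1_r; apply: Rmult_le_compat_l => //.
have := exp_ineq1_le (k * (s - t0)); nra.
Qed.

(** Sum of the geometric series of bounds in [u_step]; its tail from index [m] is
    [M t * (/ 2) ^ m]. *)
Let M t := 2 * (B / k) * exp (k * (t - t0)).

Lemma u_cauchy (m p : nat) t i : t0 <= t -> Rabs (u (addn m p) t i - u m t i) <= M t * (/ 2) ^ m.
Proof.
move=> tt; have M0 : 0 <= M t.
  have := u_step 0 i tt; have := Rabs_pos (u 1 t i - u 0 t i); rewrite /M /=; lra.
(* The subtracted term makes the bound telescope in the induction on [p]. *)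
suff : Rabs (u (addn m p) t i - u m t i) <= M t * ((/ 2) ^ m - (/ 2) ^ (addn m p)).
  have : 0 <= (/ 2) ^ (addn m p) by apply: pow_le; lra.
  nra.
elim: p => [|p IH]; first by rewrite addn0 !Rminus_diag Rabs_R0 Rmult_0_r; lra.
have := u_step (addn m p) i tt; rewrite addnS.
have := Rabs_triang (u (addn m p).+1 t i - u (addn m p) t i) (u (addn m p) t i - u m t i).
have -> : u (addn m p).+1 t i - u (addn m p) t i + (u (addn m p) t i - u m t i) =
          u (addn m p).+1 t i - u m t i by ring.
move: IH; rewrite /M /=; lra.
Qed.

Lemma half_pow_small C e : 0 < e -> exists m, C * (/ 2) ^ m < e.
Proof.
move=> e0; have C0 : 0 < Rabs C + 1 by have := Rabs_pos C; lra.
have [||m Hm] := @pow_lt_1_zero (/ 2) _ (e / (Rabs C + 1)).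
- by rewrite Rabs_pos_eq; lra.
- exact: Rdiv_lt_0_compat.
exists m; have := Hm m (le_n m); rewrite Rabs_pos_eq; last by apply: pow_le; lra.
have p0 : 0 <= (/ 2) ^ m by apply: pow_le; lra.
move/(Rmult_lt_compat_l _ _ _ C0); have -> : (Rabs C + 1) * (e / (Rabs C + 1)) = e by field; lra.
have := Rle_abs C; nra.
Qed.

Let v t i := real (Lim_seq (fun m => u m (Rmax t t0) i)).

Lemma v_lim t i : is_lim_seq (fun m => u m (Rmax t t0) i) (v t i).
Proof.
apply: Lim_seq_correct'; apply/ex_lim_seq_cauchy_corr => e.
have [m Hm] := half_pow_small (2 * M (Rmax t t0)) (cond_pos e).
exists m => p q /leP mp /leP mq.
have T := Rmax_r t t0.
have := u_cauchy m (subn p m) i T; have := u_cauchy m (subn q m) i T.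
rewrite !subnKC // => a b.
have := Rabs_triang (u p (Rmax t t0) i - u m (Rmax t t0) i) (u m (Rmax t t0) i - u q (Rmax t t0) i).
have -> : u p (Rmax t t0) i - u m (Rmax t t0) i + (u m (Rmax t t0) i - u q (Rmax t t0) i) =
  u p (Rmax t t0) i - u q (Rmax t t0) i by ring.
by rewrite (Rabs_minus_sym (u m _ i)); lra.
Qed.

Lemma v_close m t i : t0 <= t -> Rabs (v t i - u m t i) <= M t * (/ 2) ^ m.
Proof.
move=> tt; have := @v_lim t i; rewrite Rmax_left // => vl.
apply: (is_lim_seq_le (fun p => Rabs (u (addn m p) t i - u m t i)) (fun=> M t * (/ 2) ^ m)
  (Rabs (v t i - u m t i)) (M t * (/ 2) ^ m)).
- by move=> p; exact: u_cauchy.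
- apply: (is_lim_seq_abs _ (v t i - u m t i)).
  apply: is_lim_seq_minus'; last exact: is_lim_seq_const.
  apply: (is_lim_seq_ext (fun p => u (Nat.add p m) t i)); first by move=> p; rewrite plusE addnC.
  exact: (proj1 (is_lim_seq_incr_n (fun p => u p t i) m _) vl).
exact: is_lim_seq_const.
Qed.

Lemma v_lip : lip v.
Proof.
move=> s t i; apply: Rle_trans (_ : B * Rabs (Rmax s t0 - Rmax t t0) <= _); last first.
  apply: Rmult_le_compat_l (Rmax_lipschitz _ _ _).
  by have := F_bound u0 i; have := Rabs_pos (F u0 i); lra.
apply: (is_lim_seq_le (fun m => Rabs (u m (Rmax s t0) i - u m (Rmax t t0) i))
  (fun=> B * Rabs (Rmax s t0 - Rmax t t0)) (Rabs (v s i - v t i)) (B * Rabs (Rmax s t0 - Rmax t t0))).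
- by move=> m; exact: u_lip.
- apply: (is_lim_seq_abs _ (v s i - v t i)).
  by apply: is_lim_seq_minus'; exact: v_lim.
exact: is_lim_seq_const.
Qed.

(** Both sides are close to [u m.+1]: [v] as the limit of the iterates, [step v] by contraction,
    since [v] is close to [u m]. *)
Lemma step_v t i : t0 <= t -> step v t i = v t i.
Proof.
move=> tt; apply: Rminus_diag_uniq; apply: Rabs_eq_0; apply: Rle_antisym (Rabs_pos _).
apply: Rle_plus_epsilon => e e0; rewrite Rplus_0_l.
have [m Hm] := half_pow_small (2 * M t) e0.
have vu : Rabs (v t i - u m.+1 t i) <= M t * (/ 2) ^ m.+1 by exact: v_close.
have su : Rabs (step v t i - u m.+1 t i) <= 2 * (B / k) * (/ 2) ^ m / 2 * exp (k * (t - t0)).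
  apply: step_close v_lip (u_lip m) _ tt => s j ss.
  by have := v_close m j ss; rewrite /M; lra.
have := Rabs_triang (step v t i - u m.+1 t i) (u m.+1 t i - v t i).
have -> : step v t i - u m.+1 t i + (u m.+1 t i - v t i) = step v t i - v t i by ring.
rewrite (Rabs_minus_sym (u _ _ _)); move: vu su Hm; rewrite /M /=; lra.
Qed.

(** The [Rmax] makes the solution affine left of [t0], so that its derivative at [t0] is
    two-sided. *)
Theorem picard_lindelof : exists w : R -> I -> R, (forall i, w t0 i = u0 i) /\
  forall t i, is_derive (fun s => w s i) t (F (w (Rmax t t0)) i).
Proof.
(* [v] is constant left of [t0]; [step v] agrees with it from [t0] on and is differentiable
   everywhere. *)
exists (step v); split=> [i|t i]; first exact: step_t0.
have -> : step v (Rmax t t0) = v (Rmax t t0).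
  by apply: functional_extensionality => j; apply: step_v; exact: Rmax_r.
have -> : v (Rmax t t0) = v (Rmax (Rmax t t0) t0).
  by rewrite (Rmax_left (Rmax t t0)) //; exact: Rmax_r.
have := step_derive i t v_lip.
by rewrite (Rmax_left (Rmax t t0)) //; exact: Rmax_r.
Qed.
End Picard.

(** * Uniqueness, forwards and backwards in time *)

Section Gronwall.
Local Open Scope R_scope.

(** The product of [w] with [exp (- k * (t - t0))] is nonincreasing and carries the zero at [t1]
    forwards; the product with [exp (k * (t - t0))] is nondecreasing and carries it backwards. *)
Lemma gronwall_zero (w dw : R -> R) t0 k t1 :
  (forall t, t0 <= t -> is_derive w t (dw t)) -> (forall t, t0 <= t -> 0 <= w t) ->
  (forall t, t0 <= t -> Rabs (dw t) <= k * w t) ->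
  t0 <= t1 -> w t1 = 0 -> forall t, t0 <= t -> w t = 0.
Proof.
move=> wd w0 wk t01 w1 t tt; apply: Rle_antisym (w0 t tt).
have D c s : t0 <= s -> is_derive (fun s => w s * (1 * exp (c * (s - t0)))) s
   (dw s * (1 * exp (c * (s - t0))) + w s * (1 * (c * exp (c * (s - t0))))).
  move=> ss; apply: (is_derive_mult w (fun s => 1 * exp (c * (s - t0)))); [exact: wd| exact: is_derive_expl | by move=> *; rewrite /mult /=; ring].
have E c : 0 < exp (c * (t - t0)) by exact: exp_pos.
have [tt1|tt1] := Rle_lt_dec t1 t.
  have := @derive_ge0_incr (fun s => - (w s * (1 * exp (- k * (s - t0))))) _ t0
    (fun s ss => is_derive_opp _ _ _ (D (- k) s ss)) _ t1 t t01 tt1.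
  rewrite w1 => H; have : - (0 * (1 * exp (- k * (t1 - t0)))) <= - (w t * (1 * exp (- k * (t - t0)))).
    apply: H => s ss.
    change (0 <= - (dw s * (1 * exp (- k * (s - t0))) + w s * (1 * (- k * exp (- k * (s - t0)))))).
    have := wk s ss => /Rabs_le_between; move: (exp_pos (- k * (s - t0))).
    move: (exp _) => e e0 [_ b]; have : 0 <= (k * w s - dw s) * e by apply: Rmult_le_pos; lra.
    lra.
  by have := E (- k); nra.
have := @derive_ge0_incr (fun s => w s * (1 * exp (k * (s - t0)))) _ t0
    (D k) _ t t1 tt (Rlt_le _ _ tt1).
rewrite w1 => H; have : w t * (1 * exp (k * (t - t0))) <= 0 * (1 * exp (k * (t1 - t0))).
  apply: H => s ss.
  have := wk s ss => /Rabs_le_between; move: (exp_pos (k * (s - t0))).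
  move: (exp _) => e e0 [b _]; have : 0 <= (k * w s + dw s) * e by apply: Rmult_le_pos; lra.
  lra.
by have := E k; nra.
Qed.

(** Gronwall for the sum of squared differences, whose derivative is at most [2 * K * S ^ 2] in
    modulus, with [S] the sum of absolute differences. Agreement at [t1] also fixes the past back to
    [t0]. *)
Lemma ode_unique (I : finType) (F : (I -> R) -> I -> R) K t0 t1 (u v : R -> I -> R) :
  0 <= K ->
  (forall u v i, Rabs (F u i - F v i) <= K * \rsum_j Rabs (u j - v j)) ->
  (forall t i, t0 <= t -> is_derive (fun s => u s i) t (F (u t) i)) ->
  (forall t i, t0 <= t -> is_derive (fun s => v s i) t (F (v t) i)) ->
  t0 <= t1 -> (forall i, u t1 i = v t1 i) ->
  forall t i, t0 <= t -> u t i = v t i.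
Proof.
move=> K0 F_lip ud vd t01 uv1 t i tt.
pose d s i := u s i - v s i.
pose dd s i := F (u s) i - F (v s) i.
have W : \rsum_i (d t i) ^ 2 = 0.
  apply: (@gronwall_zero (fun s => \rsum_i (d s i) ^ 2) (fun s => \rsum_i (2 * d s i * dd s i))
    t0 (2 * K * INR #|I|) t1) => // [s ss|s ss|s ss|].
  - apply: (@is_derive_rsum I (fun i s => (d s i) ^ 2)) => j.
    have dj : is_derive (fun s => d s j) s (dd s j).
      by apply: (is_derive_minus (fun s => u s j)); [exact: ud | exact: vd].
    have -> : 2 * d s j * dd s j = INR 2 * dd s j * d s j ^ 1 by rewrite /=; ring.
    exact: (is_derive_pow _ 2).
  - by apply: rsum_ge0 => j; exact: pow2_ge_0.
  - apply: Rle_trans (rsum_abs _) _.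
    set S := \rsum_j Rabs (d s j).
    have S2 : S ^ 2 <= INR #|I| * \rsum_j (d s j) ^ 2.
      have := rsum_sqr (fun j => Rabs (d s j)).
      by under [X in _ <= _ * X -> _]eq_bigr => j _ do rewrite pow2_abs.
    apply: Rle_trans (_ : 2 * K * S ^ 2 <= _); last first.
      have K2 : 0 <= 2 * K by lra.
      by have := Rmult_le_compat_l _ _ _ K2 S2; lra.
    apply: Rle_trans (_ : \rsum_j (2 * K * S * Rabs (d s j)) <= _).
      apply: rsum_le => j; rewrite !Rabs_mult (Rabs_pos_eq 2); last lra.
      have := F_lip (u s) (v s) j; have := Rabs_pos (d s j); rewrite -/(dd s j) -/S; nra.
    by rewrite rsumM -/S /=; lra.
  rewrite (eq_bigr (fun=> 0)) ?rsum_const; first lra.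
  by move=> j _; rewrite /d uv1; ring.
have := rsum_eq0 (F := fun i => (d t i) ^ 2) (fun j => pow2_ge_0 _) (Req_le _ _ W) i.
rewrite /d; nra.
Qed.
End Gronwall.

(** * Derivatives of trace functionals *)

Lemma derive_le0_decr (f : R -> R) t0 :
  (forall t, (t0 <= t)%R -> exists2 l, is_derive f t l & (l <= 0)%R) ->
  forall s t, (t0 <= s)%R -> (s <= t)%R -> (f t <= f s)%R.
Proof.
move=> H s t s0 st; apply: Ropp_le_cancel.
apply: (@derive_ge0_incr (fun r => - f r)%R (fun r => - Derive f r)%R t0) => // r rr;
  have [l fl l0] := H r rr; rewrite (is_derive_unique _ _ _ fl); last lra.
exact: (is_derive_opp f).
Qed.

Lemma is_derive_squeeze (r q : R -> R) t : (forall s, 0 <= r s <= q s)%R -> q t = 0%R ->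
  is_derive q t (0%R : R) -> is_derive r t (0%R : R).
Proof.
move=> rq q0 /is_derive_Reals qd; apply/is_derive_Reals => eps eps0.
have [d Hd] := qd eps eps0; exists d => h h0 hd.
have := Hd h h0 hd; rewrite q0 !Rminus_0_r; have [r0 r0'] := rq t.
have -> : r t = 0%R by lra.
rewrite !Rminus_0_r /Rdiv !Rabs_mult => H; apply: Rle_lt_trans H.
apply: Rmult_le_compat_r; first exact: Rabs_pos.
by have [a b] := rq (t + h)%R; rewrite !Rabs_pos_eq //; lra.
Qed.

(** Two-sided, unlike [deriv_within], so that the rules for [is_derive] apply at [t0] as well. *)
Definition mderiv n (c : R -> 'M[cpx]_n) (t : R) (D : 'M[cpx]_n) : Prop :=
  forall i j, is_derive (fun s => Re (c s i j)) t (Re (D i j)) /\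
              is_derive (fun s => Im (c s i j)) t (Im (D i j)).

Lemma ipE n (A B : 'M[cpx]_n) :
  ip A B = \rsum_i \rsum_j (Re (A i j) * Re (B j i) - Im (A i j) * Im (B j i)).
Proof.
rewrite /ip /mxtrace Re_sum; apply: eq_bigr => i _; rewrite mxE Re_sum.
by apply: eq_bigr => j _.
Qed.

Lemma is_derive_ip n (A : 'M[cpx]_n) c t D : mderiv c t D ->
  is_derive (fun s => ip A (c s)) t (ip A D).
Proof.
move=> cd; rewrite ipE; apply: (is_derive_ext (fun s =>
  \rsum_i \rsum_j (Re (A i j) * Re (c s j i) - Im (A i j) * Im (c s j i)))).
  by move=> s; rewrite ipE.
apply: (@is_derive_rsum _ (fun i s => \rsum_j (Re (A i j) * Re (c s j i) - Im (A i j) * Im (c s j i)))) => i.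
apply: (@is_derive_rsum _ (fun j s => (Re (A i j) * Re (c s j i) - Im (A i j) * Im (c s j i))%R)) => j.
have [re im] := cd j i.
apply: (is_derive_minus (fun s => Re (A i j) * Re (c s j i))%R (fun s => Im (A i j) * Im (c s j i))%R).
  exact: (is_derive_scal (fun s => Re (c s j i))).
exact: (is_derive_scal (fun s => Im (c s j i))).
Qed.

Lemma is_derive_trace n (c : R -> 'M[cpx]_n) t D : mderiv c t D ->
  is_derive (fun s => Re (\tr (c s))) t (Re (\tr D)) /\
  is_derive (fun s => Im (\tr (c s))) t (Im (\tr D)).
Proof.
move=> cd; split.
  rewrite /mxtrace Re_sum; apply: (is_derive_ext (fun s => \rsum_i Re (c s i i))).
    by move=> s; rewrite Re_sum.
  by apply: (is_derive_rsum (f := fun i s => Re (c s i i))) => i; have [] := cd i i.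
rewrite /mxtrace Im_sum; apply: (is_derive_ext (fun s => \rsum_i Im (c s i i))).
  by move=> s; rewrite Im_sum.
by apply: (is_derive_rsum (f := fun i s => Im (c s i i))) => i; have [] := cd i i.
Qed.

(** The squared distance is of second order at [t]; it bounds the remainder in
    [is_derive_ftrace]. *)
Lemma is_derive_hs2 n (c : R -> 'M[cpx]_n) t D : mderiv c t D ->
  is_derive (fun s => hs2 (c s - c t)) t (0%R : R).
Proof.
move=> cd.
have sq (f : R -> R) l : is_derive f t l -> is_derive (fun s => (f s - f t) * (f s - f t))%R t (0%R : R).
  move=> fl; have gl : is_derive (fun s => f s - f t)%R t l.
    rewrite -[l]Rminus_0_r; apply: (is_derive_minus f); [done | exact: is_derive_const].
  have := is_derive_mult _ _ t _ _ gl gl Rmult_comm.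
  by rewrite /plus /mult /= Rminus_diag Rmult_0_r Rmult_0_l Rplus_0_l.
have -> : (0%R : R) = \big[Rplus/IZR 0]_(i < n) \big[Rplus/IZR 0]_(j < n) (0 + 0)%R.
  by rewrite !rsum_const; lra.
pose q s := c s - c t.
apply: (is_derive_rsum (f := fun i s => \rsum_j nsq (q s i j))) => i.
apply: (is_derive_rsum (f := fun j s => nsq (q s i j))) => j.
apply: (is_derive_ext (fun s => (Re (c s i j) - Re (c t i j)) * (Re (c s i j) - Re (c t i j)) +
                        (Im (c s i j) - Im (c t i j)) * (Im (c s i j) - Im (c t i j)))%R).
  by move=> s; rewrite /nsq !mxE.
have [re im] := cd i j.
by apply: (is_derive_plus (fun s => (Re (c s i j) - Re (c t i j)) * (Re (c s i j) - Re (c t i j)))%R); [exact: (sq (fun s => Re (c s i j)) _ re) | exact: (sq (fun s => Im (c s i j)) _ im)].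
Qed.

(** An arbitrary choice of eigenbasis; [spect_unique] makes [fcalc] and [ftrace] independent of it.
    Off Hermitian matrices the value carries no meaning. *)
Definition diagonalization n (c : 'M[cpx]_n) : 'M[cpx]_n * ('I_n -> R) :=
  epsilon (inhabits (0, fun=> R0)) (fun p => is_unitary p.1 /\ c = spect p.1 p.2).
Definition fcalc n (f : R -> R) (c : 'M[cpx]_n) : 'M[cpx]_n :=
  spect (diagonalization c).1 (fun i => f ((diagonalization c).2 i)).
Definition ftrace n (f : R -> R) (c : 'M[cpx]_n) : R :=
  \rsum_i f ((diagonalization c).2 i).

Section Calculus.
Variable n : nat.
Implicit Types (a b c U W : 'M[cpx]_n) (f g : R -> R) (d : 'I_n -> R).

Lemma diagonalizationP c : is_hermitian c ->
  is_unitary (diagonalization c).1 /\ c = spect (diagonalization c).1 (diagonalization c).2.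
Proof.
move=> /hermitian_spectral [U [d [hU E]]].
by apply: (epsilon_spec _ (fun p => is_unitary p.1 /\ c = spect p.1 p.2)); exists (U, d).
Qed.

Lemma fcalcE f U d : is_unitary U -> fcalc f (spect U d) = spect U (fun i => f (d i)).
Proof.
move=> hU; have [hV E] := diagonalizationP (hermitian_spect U d).
exact: spect_unique.
Qed.

Lemma hermitian_fcalc f c : is_hermitian (fcalc f c).
Proof. exact: hermitian_spect. Qed.

Lemma mxtrace_spect U d : is_unitary U -> \tr (spect U d) = RtoC (\rsum_i d i).
Proof.
move=> hU; rewrite /spect mxtrace_mulC mulmxA hU mul1mx /mxtrace RtoC_sum.
by apply: eq_bigr => i _; rewrite !mxE eqxx.
Qed.

Lemma ftraceE f U d : is_unitary U -> ftrace f (spect U d) = \rsum_i f (d i).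
Proof.
move=> hU; have [hV E] := diagonalizationP (hermitian_spect U d).
apply: RtoC_inj; rewrite /ftrace -(mxtrace_spect _ hV) -(mxtrace_spect _ hU).
by congr mxtrace; apply: spect_unique.
Qed.

(** By [ip_spect_diff] both squared norms are sums over the same weights, and the scalar estimate
    applies to each term. *)
Lemma fcalc_lip f K a b : is_hermitian a -> is_hermitian b ->
  (forall s t, Rabs (f s - f t) <= K * Rabs (s - t))%R ->
  (hs2 (fcalc f a - fcalc f b) <= K ^ 2 * hs2 (a - b))%R.
Proof.
move=> ha hb fK; rewrite !hs2_ip; try by apply: hermitianB => //; apply: hermitian_fcalc.
have [hU Ea] := diagonalizationP ha; have [hW Eb] := diagonalizationP hb.
rewrite /fcalc; move: hU hW Ea Eb.
move: (diagonalization a) (diagonalization b) => [U d] [W e] /= hU hW -> ->.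
rewrite !ip_spect_diff // -rsum2M; apply: rsum2_le => i j.
have := overlap_ge0 U 1%:M W i j; set p := overlap _ _ _ _ _ => p0.
move: (d i) (e j) => s t.
suff : ((f s - f t) * (f s - f t) <= K ^ 2 * ((s - t) * (s - t)))%R by nra.
have := fK s t; have := Rabs_pos (f s - f t).
rewrite -[((f s - f t) * _)%R]/(Rsqr (f s - f t)) -[((s - t) * _)%R]/(Rsqr (s - t)).
rewrite (Rsqr_abs (f s - f t)) (Rsqr_abs (s - t)) /Rsqr; nra.
Qed.

Lemma klein_fcalc f g a b : is_hermitian a -> is_hermitian b ->
  (forall s t, g s * (t - s) <= f t - f s)%R ->
  (ip (fcalc g a) (b - a) <= ftrace f b - ftrace f a)%R.
Proof.
move=> ha hb fg.
have [hU Ea] := diagonalizationP ha; have [hW Eb] := diagonalizationP hb.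
by rewrite {2}Ea {1}Eb; apply: klein.
Qed.

(* Klein's inequality at both endpoints squeezes the increment of the trace between its
   linearization and the linearization plus [K] times the squared distance. *)
Lemma is_derive_ftrace f g K (c : R -> 'M[cpx]_n) t D :
  (forall s t, g s * (t - s) <= f t - f s)%R ->
  (forall s t, Rabs (g s - g t) <= K * Rabs (s - t))%R ->
  (forall s, is_hermitian (c s)) -> mderiv c t D ->
  is_derive (fun s => ftrace f (c s)) t (ip (fcalc g (c t)) D).
Proof.
move=> fg gK hc cd; set G := fcalc g (c t).
pose r s := (ftrace f (c s) - ftrace f (c t) - ip G (c s - c t))%R.
have rd : is_derive r t (0%R : R).
  apply: (@is_derive_squeeze r (fun s => K * hs2 (c s - c t))%R); last first.
  - rewrite -(Rmult_0_r K); apply: (is_derive_scal (fun s => hs2 (c s - c t))).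
    exact: is_derive_hs2 cd.
  - rewrite subrr hs2E mul0mx mxtrace0 /=; lra.
  move=> s; split; first by have := klein_fcalc (hc t) (hc s) fg; rewrite /r /G; lra.
  have up : (- ip (fcalc g (c s)) (c s - c t) <= ftrace f (c t) - ftrace f (c s))%R.
    by rewrite -ipNr opprB; apply: klein_fcalc.
  suff : (ip (fcalc g (c s) - G) (c s - c t) <= K * hs2 (c s - c t))%R.
    rewrite ipBl /r; lra.
  rewrite hs2_ip; last exact: hermitianB.
  have [hU Es] := diagonalizationP (hc s); have [hW Et] := diagonalizationP (hc t).
  rewrite /G /fcalc; move: hU hW Es Et.
  move: (diagonalization (c s)) (diagonalization (c t)) => [U d] [W e] /= hU hW -> ->.
  rewrite !ip_spect_diff // -rsum2M; apply: rsum2_le => i j.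
  have := overlap_ge0 U 1%:M W i j; set p := overlap _ _ _ _ _ => p0.
  suff : ((g (d i) - g (e j)) * (d i - e j) <= K * ((d i - e j) * (d i - e j)))%R by nra.
  have := gK (d i) (e j); rewrite /Rabs; do 2 case: Rcase_abs => ?; nra.
apply: (is_derive_ext (fun s => r s + (ftrace f (c t) - ip G (c t) + ip G (c s)))%R).
  by move=> s; rewrite /r ipBr; lra.
rewrite -[ip G D]Rplus_0_l; apply: (is_derive_plus r) => //.
rewrite -[ip G D]Rplus_0_l; apply: (is_derive_plus (fun=> ftrace f (c t) - ip G (c t))%R).
  exact: is_derive_const.
exact: is_derive_ip.
Qed.

(** The Dirichlet form of [lap]: by [hs2_mcomm] it equals [ip c (lap x y c)] for Hermitian
    matrices. *)
Definition energy (x y c : 'M[cpx]_n) : R := (hs2 (mcomm x c) + hs2 (mcomm y c))%R.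

(** The energy is the same weighted sum with [f = h = d], so the comparison is termwise. [k = 0]
    expresses mere dissipation, [k > 0] coercivity. *)
Lemma ip_lap x y U d k (f h : 'I_n -> R) : is_hermitian x -> is_hermitian y -> is_unitary U ->
  (forall i j, k * (d i - d j) ^ 2 <= (f i - f j) * (h i - h j))%R ->
  (k * energy x y (spect U d) <= ip (spect U f) (lap x y (spect U h)))%R.
Proof.
move=> hx hy hU H.
rewrite lapE /energy !hs2_mcomm //; try exact: hermitian_spect.
rewrite ipDr !ip_spect_mcomm // -rsum2D -rsum2D -rsum2M; apply: rsum2_le => i j.
have := overlap_ge0 U x U i j; have := overlap_ge0 U y U i j; have := H i j.
move: (overlap U x U i j) (overlap U y U i j) => p q; move: (f i - f j)%R (h i - h j)%R => a b; nra.
Qed.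
End Calculus.

(** * Spectral gap of the Laplacian *)

Lemma is_lim_seq_rsum (I : finType) (f : I -> nat -> R) (l : I -> R) :
  (forall i, is_lim_seq (f i) (l i)) ->
  is_lim_seq (fun N => \rsum_i f i N) (\rsum_i l i).
Proof.
move=> fl; rewrite -big_enum.
apply: (is_lim_seq_ext (fun N => \big[Rplus/IZR 0]_(i <- enum I) f i N)).
  by move=> N; rewrite big_enum.
elim: (enum I) => [|a s IH].
  rewrite big_nil; apply: (is_lim_seq_ext (fun=> 0%R)) => [N|]; [by rewrite big_nil | exact: is_lim_seq_const].
rewrite big_cons; apply: (is_lim_seq_ext (fun N => f a N + \big[Rplus/IZR 0]_(i <- s) f i N)%R).
  by move=> N; rewrite big_cons.
exact: is_lim_seq_plus'.
Qed.

Section Commutant.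
Variable n : nat.
Implicit Types (a x y A E : 'M[cpx]_n).

Lemma mexp_ip_lim B A E : is_mexp A E ->
  is_lim_seq (fun N => ip B (exp_partial A N)) (ip B E).
Proof.
move=> AE; rewrite ipE; apply: (is_lim_seq_ext (fun N => \rsum_i \rsum_j
  (Re (B i j) * Re (exp_partial A N j i) - Im (B i j) * Im (exp_partial A N j i)))).
  by move=> N; rewrite ipE.
apply: (is_lim_seq_rsum (f := fun i N => \rsum_j
  (Re (B i j) * Re (exp_partial A N j i) - Im (B i j) * Im (exp_partial A N j i)))) => i.
apply: (is_lim_seq_rsum (f := fun j N =>
  (Re (B i j) * Re (exp_partial A N j i) - Im (B i j) * Im (exp_partial A N j i))%R)) => j.
have [/is_lim_seq_Reals re /is_lim_seq_Reals im] := AE j i.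
apply: is_lim_seq_minus'.
  exact: (is_lim_seq_scal_l _ (Re (B i j)) _ re).
exact: (is_lim_seq_scal_l _ (Im (B i j)) _ im).
Qed.

Lemma comm_exp_partial A a N : a *m A = A *m a ->
  a *m exp_partial A N = exp_partial A N *m a.
Proof.
move=> aA; rewrite /exp_partial mulmx_sumr mulmx_suml; apply: eq_bigr => k _.
rewrite -scalemxAr -scalemxAl; congr (_ *: _).
elim: (nat_of_ord k) => [|p IH]; first by rewrite /mpow /= mulmx1 mul1mx.
by rewrite /mpow /= -/(mpow A p) mulmxA aA -(mulmxA A a) IH mulmxA.
Qed.

(** The commutator with [E] is paired with its own adjoint; the pairing is a limit of pairings with
    commutators of partial sums, all zero. *)
Lemma comm_mexp A E a : is_mexp A E -> a *m A = A *m a -> a *m E = E *m a.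
Proof.
move=> AE aA; apply/eqP; rewrite -subr_eq0; apply/eqP; apply: hs2_eq0.
pose B := adjoint (a *m E - E *m a).
(* Cyclicity of the trace moves the commutator onto [B], which leaves a fixed linear functional of
   [M]. *)
have cyc M : ip B (a *m M - M *m a) = ip (B *m a - a *m B) M.
  rewrite ipBr ipBl /ip !mulmxA; congr Rminus.
  by rewrite mxtrace_mulC !mulmxA.
rewrite hs2E mxtrace_mulC -/B -/(ip B _) cyc; apply: Req_le.
have /is_lim_seq_unique := @mexp_ip_lim (B *m a - a *m B) _ _ AE.
rewrite (Lim_seq_ext _ (fun=> 0%R)) ?Lim_seq_const; first by case.
by move=> N; rewrite -cyc comm_exp_partial // subrr /ip mulmx0 mxtrace0.
Qed.

Lemma CexpiX th k : Cexpi th ^+ k = Cexpi (INR k * th).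
Proof.
elim: k => [|k IH].
  by rewrite expr0 /Cexpi Rmult_0_l cos_0 sin_0.
rewrite exprS IH S_INR Rmult_plus_distr_r Rmult_1_l Rplus_comm /Cexpi cos_plus sin_plus.
by apply: cpx_eq => /=; ring.
Qed.

(** Equal powers make [(j - i) * m / n] an integer; by coprimality [n] divides [j - i], which lies
    strictly between 0 and [n]. *)
Lemma qrootX_inj m i j : (0 < n)%N -> coprime m n -> (i < j)%N -> (j < n)%N ->
  qroot n m ^+ i <> qroot n m ^+ j.
Proof.
move=> n0 cmn ij jn; rewrite /qroot !CexpiX => -[c s].
pose th := (2 * PI * INR m / INR n)%R; rewrite -/th in c s.
have nR : (INR n <> 0)%R by apply: not_0_INR => n_0; rewrite n_0 in n0.
have : cos (INR (j - i) * th) = 1%R.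
  have -> : (INR (j - i) * th = INR j * th - INR i * th)%R.
    by rewrite minus_INR; [ring | apply/leP; apply: ltnW].
  by rewrite cos_minus c s; have := sin2_cos2 (INR j * th); rewrite /Rsqr; lra.
(* An angle of cosine 1 has a half of sine 0, which is therefore an integer multiple of [PI]. *)
have -> : (INR (j - i) * th = 2 * (INR (j - i) * th / 2))%R by field.
rewrite cos_2a_sin => h.
have /sin_eq_0_0 [z hz] : sin (INR (j - i) * th / 2) = 0%R by nra.
have zE : (INR (j - i) * INR m = IZR z * INR n)%R.
  have P0 := PI_RGT_0; apply: (Rmult_eq_reg_r PI); last lra.
  have -> : (IZR z * INR n * PI = IZR z * PI * INR n)%R by ring.
  by rewrite -hz /th; field.
move: zE; rewrite -mult_INR !INR_IZR_INZ -mult_IZR => /eq_IZR zE.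
have : (n %| (j - i) * m)%N.
  have n_gt0 : Z.lt 0 (Z.of_nat n) by apply/(Nat2Z.inj_lt 0)/leP.
  have z0 : Z.le 0 z.
    apply: (Zmult_le_0_reg_r (Z.of_nat n)); first exact: Z.lt_gt.
    by rewrite -zE; apply: Nat2Z.is_nonneg.
  apply/dvdnP; exists (Z.to_nat z); apply/Nat2Z.inj.
  by rewrite -multE (Nat2Z.inj_mul (Z.to_nat z)) Z2Nat.id.
rewrite Gauss_dvdl; last by rewrite coprime_sym.
move/dvdn_leq; rewrite subn_gt0 => /(_ ij) le.
by have := leq_trans le (leq_subr i j); rewrite leqNgt jn.
Qed.

(** [umat] has distinct diagonal entries, so commuting with it forces [a] to be diagonal; commuting
    with the shift equates consecutive diagonal entries. *)
Lemma comm_clock_shift m a : (0 < n)%N -> coprime m n ->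
  a *m umat n m = umat n m *m a -> a *m vmat n = vmat n *m a ->
  exists b, a = b%:M.
Proof.
move=> n0 cmn au av.
have off i j : i != j -> a i j = 0.
  move=> ij; move/matrixP: au => /(_ i j).
  rewrite /umat mul_mx_diag mul_diag_mx !mxE [RHS]mulrC => /eqP.
  rewrite -subr_eq0 -mulrBr mulf_eq0 subr_eq0 => /orP [/eqP //|/eqP].
  by case: (ltngtP i j) ij => [lt|lt|/ord_inj ->]; rewrite ?eqxx // => _;
    [move/esym|]; move/(qrootX_inj n0 cmn lt (ltn_ord _)).
have aD : a = diag_mx (\row_i a i i).
  apply/matrixP => i j; rewrite !mxE; case: eqVneq => [-> //|ij].
  by rewrite off // mulr0n.
have next (i j : 'I_n) : j = i.+1 :> nat -> a j j = a i i.
  move=> ij; move: av; rewrite aD mul_mx_diag mul_diag_mx => /matrixP /(_ i j).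
  by rewrite !mxE ij modn_small -?ij ?ltn_ord // eqxx mulr1 mul1r !eqxx !mulr1n => ->.
pose o := Ordinal n0; exists (a o o).
have all_eq k (hk : (k < n)%N) : a (Ordinal hk) (Ordinal hk) = a o o.
  elim: k hk => [|k IH] hk; first by congr (a _ _); apply: ord_inj.
  by rewrite -(IH (ltnW hk)); apply: next.
rewrite aD; apply/matrixP => i j; rewrite !mxE; case: eqVneq => [_|//].
by case: i => k hk; rewrite all_eq !eqxx !mulr1n.
Qed.

Lemma commutant_scalar m x y a : (0 < n)%N -> coprime m n ->
  is_mexp (two_pi_i_over n *: x) (umat n m) ->
  is_mexp (two_pi_i_over n *: y) (vmat n) ->
  mcomm x a = 0 -> mcomm y a = 0 -> exists b, a = b%:M.
Proof.
move=> n0 cmn hu hv /subr0_eq xa /subr0_eq ya.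
apply: (comm_clock_shift n0 cmn).
  by apply: comm_mexp hu _; rewrite -scalemxAl -scalemxAr xa.
by apply: comm_mexp hv _; rewrite -scalemxAl -scalemxAr ya.
Qed.
End Commutant.

(** * Bounded linear maps and the gap estimate *)

Definition rvn n (w : 'rV[cpx]_n) : R := \rsum_k nsq (w ord0 k).

Lemma nsqM z w : nsq (z * w) = (nsq z * nsq w)%R.
Proof. rewrite /nsq !(ReM, ImM); ring. Qed.

Lemma nsq_sum (I : finType) (z : I -> cpx) :
  Rle (nsq (\sum_i z i)) (INR #|I| * \rsum_i nsq (z i))%R.
Proof.
rewrite /nsq Re_sum Im_sum.
have := rsum_sqr (fun i => Re (z i)); have := rsum_sqr (fun i => Im (z i)).
have -> : \rsum_i (Re (z i) * Re (z i) + Im (z i) * Im (z i)) =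
  (\rsum_i (Re (z i)) ^ 2 + \rsum_i (Im (z i)) ^ 2)%R.
  by rewrite -rsumD; apply: eq_bigr => i _; ring.
lra.
Qed.

Lemma rvn_mul p q (P : 'M[cpx]_(p, q)) :
  exists2 C, (0 < C)%R & forall w : 'rV_p, (rvn (w *m P) <= C * rvn w)%R.
Proof.
have nn k j : (0 <= nsq (P k j))%R by exact: nsq_ge0.
pose S := \rsum_k \rsum_j nsq (P k j).
have S0 : (0 <= S)%R by exact: rsum2_ge0.
(* [S] is the sum of the squared moduli of the entries of [P], the factor [p] comes from
   Cauchy-Schwarz, and the [+ 1] makes the constant positive. *)
exists (INR p * S + 1)%R.
  have := pos_INR p; nra.
move=> w; have w0 : (0 <= rvn w)%R by apply: rsum_ge0 => k; apply: nsq_ge0.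
apply: Rle_trans (_ : INR p * (S * rvn w) <= _)%R; last by nra.
rewrite /rvn /S [X in (_ <= _ * (X * _))%R]rsum_exch.
apply: Rle_trans (_ : \rsum_j (INR p * (rvn w * \rsum_k nsq (P k j))) <= _)%R.
  apply: rsum_le => j; rewrite mxE.
  apply: Rle_trans (nsq_sum _) _; rewrite card_ord.
  apply: Rmult_le_compat_l; first exact: pos_INR.
  rewrite -rsumM; apply: rsum_le => k; rewrite nsqM; apply: Rmult_le_compat_r => //.
  by apply: (rsum_term (F := fun k => nsq (w ord0 k))) => l; apply: nsq_ge0.
rewrite rsumM rsumM -/(rvn w); have := pos_INR p; nra.
Qed.

Lemma rvn_mxvec n (a : 'M[cpx]_n) : rvn (mxvec a) = hs2 a.
Proof.
rewrite /rvn /hs2 (reindex _ (curry_mxvec_bij n n)) pair_bigA /=.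
by apply: eq_bigr => -[i j] _ /=; rewrite mxvecE.
Qed.

Lemma rvn_row_mx p q (v : 'rV[cpx]_p) (w : 'rV_q) : rvn (row_mx v w) = (rvn v + rvn w)%R.
Proof.
rewrite /rvn big_split_ord /=; congr Rplus; apply: eq_bigr => k _.
  by rewrite row_mxEl.
by rewrite row_mxEr.
Qed.

(** Convertible to [c_infty], but applied along the whole flow. *)
Definition mean n (a : 'M[cpx]_n) : cpx := RtoC (/ INR n) * \tr a.

Lemma natrC k : k%:R = RtoC (INR k).
Proof. by elim: k => [|k IH] //; rewrite S_INR RtoCD -IH -natr1. Qed.

(** Pythagoras: [a - (mean a)%:M] has trace zero, hence is orthogonal to the scalar matrices. *)
Lemma hs2_mean n (a : 'M[cpx]_n) b : (0 < n)%N -> (hs2 (a - (mean a)%:M) <= hs2 (a - b%:M))%R.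
Proof.
move=> n0; set A := a - (mean a)%:M; have nR : (0 < INR n)%R by apply/lt_0_INR/leP.
have trA : \tr A = 0.
  rewrite /A mxtraceB mxtrace_scalar /mean -mulr_natr.
  suff -> : (RtoC (/ INR n) * \tr a * n%:R = \tr a) by rewrite subrr.
  rewrite mulrAC; suff -> : RtoC (/ INR n) * n%:R = 1 by rewrite mul1r.
  by rewrite natrC -RtoCM Rinv_l //; lra.
have -> : a - b%:M = A + (mean a - b)%:M.
  by rewrite /A raddfB /= addrA subrK.
move: (mean a - b) => s; rewrite !hs2E adjointD.
have -> : adjoint (s%:M : 'M[cpx]_n) = (Cconj s)%:M by rewrite /adjoint tr_scalar_mx map_scalar_mx.
have trA' : \tr (adjoint A) = 0.
  transitivity (Cconj (\tr A)); last by rewrite trA rmorph0.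
  by rewrite /mxtrace rmorph_sum; apply: eq_bigr => i _; rewrite [LHS]mxE [A^T i i]mxE.
have -> : \tr ((A + s%:M) *m (adjoint A + (Cconj s)%:M)) =
    \tr (A *m adjoint A) + RtoC (INR n * nsq s).
  rewrite mulmxDl !mulmxDr !mxtraceD mul_mx_scalar mul_scalar_mx !mxtraceZ trA trA'.
  rewrite !mulr0 addr0 add0r -scalar_mxM mxtrace_scalar mulconj -mulr_natr natrC.
  by rewrite -RtoCM Rmult_comm.
by rewrite ReD /=; have := nsq_ge0 s; nra.
Qed.

Definition mcomm_mx n (z : 'M[cpx]_n) : 'M[cpx]_(n * n) :=
  lin_mx (mulmx z) - lin_mx (mulmxr z).

Lemma mcomm_mxE n (z a : 'M[cpx]_n) : mxvec a *m mcomm_mx z = mxvec (mcomm z a).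
Proof. by rewrite /mcomm_mx mulmxBr !mul_vec_lin /= -raddfB. Qed.

(** The map from [a] to its commutators with [x] and [y] has only scalars in its kernel; a norm
    bound for a pseudo-inverse of its matrix gives [C]. *)
Lemma spectral_gap n m (x y : 'M[cpx]_n) : (0 < n)%N -> coprime m n ->
  is_mexp (two_pi_i_over n *: x) (umat n m) ->
  is_mexp (two_pi_i_over n *: y) (vmat n) ->
  exists2 C, (0 < C)%R & forall a, (hs2 (a - (mean a)%:M) <= C * energy x y a)%R.
Proof.
move=> n0 cmn hu hv.
pose f := row_mx (mcomm_mx x) (mcomm_mx y).
have fE a : mxvec a *m f = row_mx (mxvec (mcomm x a)) (mxvec (mcomm y a)).
  by rewrite /f mul_mx_row !mcomm_mxE.
have [C C0 HC] := rvn_mul (pinvmx f).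
(* [w] has the same commutators as [a], so it differs from [a] by a scalar, and its norm is
   controlled by those commutators. *)
exists C => // a; pose w := mxvec a *m f *m pinvmx f.
have wf : w *m f = mxvec a *m f by rewrite /w mulmxKpV // submxMl.
have [b Eb] : exists b, a - vec_mx w = b%:M.
  have /eq_row_mx [kx ky] : row_mx (mxvec (mcomm x (a - vec_mx w))) (mxvec (mcomm y (a - vec_mx w))) = row_mx 0 0.
    by rewrite -fE raddfB /= vec_mxK mulmxBl wf subrr row_mx0.
  by apply: (commutant_scalar n0 cmn hu hv); apply: (can_inj mxvecK); rewrite ?kx ?ky raddf0.
apply: Rle_trans (hs2_mean a b n0) _.
have -> : a - b%:M = vec_mx w by rewrite -Eb opprB addrC subrK.
rewrite -rvn_mxvec vec_mxK; apply: Rle_trans (HC _) _.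
by rewrite fE rvn_row_mx !rvn_mxvec; apply: Rle_refl.
Qed.

(** * The truncated flow *)

Section RealFunctions.
Local Open Scope R_scope.

(** This is [1 + r <= exp r] at [r = ln (a / b)]. *)
Lemma ln_sub_le a b : 0 < a -> 0 < b -> ln a - ln b <= (a - b) / b.
Proof.
move=> a0 b0; rewrite -ln_div //; have q0 : 0 < a / b by exact: Rdiv_lt_0_compat.
have := exp_ineq1_le (ln (a / b)); rewrite exp_ln //.
have -> : (a - b) / b = a / b - 1 by field; lra.
lra.
Qed.

Lemma ln_nondecr a b : 0 < a -> 0 < b -> 0 <= (a - b) * (ln a - ln b).
Proof.
move=> a0 b0; case: (Rtotal_order a b) => [lt|[->|gt]]; last 2 first.
- by rewrite Rminus_diag; lra.
- by have := ln_increasing _ _ b0 gt; nra.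
by have := ln_increasing _ _ a0 lt; nra.
Qed.

(** The logarithm has slope at least [/ M] between 0 and [M]. *)
Lemma ln_coercive M a b : 0 < a <= M -> 0 < b <= M ->
  / M * (a - b) ^ 2 <= (a - b) * (ln a - ln b).
Proof.
have W u v : 0 < u <= M -> 0 < v <= M -> u <= v -> / M * (u - v) ^ 2 <= (u - v) * (ln u - ln v).
  move=> [u0 uM] [v0 vM] uv; have := ln_sub_le u0 v0.
  have : / M <= / v by apply: Rinv_le_contravar.
  have : 0 < / M by apply: Rinv_0_lt_compat; lra.
  rewrite /Rdiv; move: (ln u - ln v) (/ M) (/ v) => l p q p0 pq le.
  have h1 := Rmult_le_compat_r _ _ _ (pow2_ge_0 (u - v)) pq.
  have h2 : 0 <= (v - u) * ((u - v) * q - l) by apply: Rmult_le_pos; lra.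
  lra.
move=> ha hb; case: (Rle_dec a b) => ab; first exact: W.
have -> : (a - b) ^ 2 = (b - a) ^ 2 by ring.
have -> : (a - b) * (ln a - ln b) = (b - a) * (ln b - ln a) by ring.
apply: W => //; lra.
Qed.

Definition clamp (lo hi s : R) : R := Rmin (Rmax s lo) hi.

Lemma clamp_range lo hi s : lo <= hi -> lo <= clamp lo hi s <= hi.
Proof.
move=> lh; rewrite /clamp; split; last exact: Rmin_r.
by apply: Rmin_glb => //; exact: Rmax_r.
Qed.

Lemma clamp_id lo hi s : lo <= s <= hi -> clamp lo hi s = s.
Proof. by move=> [a b]; rewrite /clamp Rmax_left // Rmin_left. Qed.

Lemma clamp_mono lo hi s t : s <= t -> clamp lo hi s <= clamp lo hi t.
Proof. by move=> st; apply: Rle_min_compat_r; apply: Rle_max_compat_r. Qed.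

Lemma clamp_lipschitz lo hi s t : lo <= hi -> s <= t -> clamp lo hi t - clamp lo hi s <= t - s.
Proof.
rewrite /clamp /Rmin /Rmax => lh st.
case: (Rle_dec s lo) => ?; case: (Rle_dec t lo) => ?;
  by repeat match goal with |- context [Rle_dec ?a ?b] => case: (Rle_dec a b) => ? end; lra.
Qed.

Definition clamp_ln (lo hi s : R) : R := ln (clamp lo hi s).

Section ClampLn.
Variables lo hi : R.
Hypotheses (lo0 : 0 < lo) (lohi : lo <= hi).

Lemma clamp_ln_mono s t : 0 <= (s - t) * (clamp_ln lo hi s - clamp_ln lo hi t).
Proof.
have W a b : a <= b -> clamp_ln lo hi a <= clamp_ln lo hi b.
  move=> ab; apply: ln_le; last exact: clamp_mono.
  by have := clamp_range a lohi; lra.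
by case: (Rle_dec s t) => st; [have := W s t st | have := W t s]; nra.
Qed.

Lemma clamp_ln_lipschitz s t : Rabs (clamp_ln lo hi s - clamp_ln lo hi t) <= / lo * Rabs (s - t).
Proof.
have W a b : a <= b -> Rabs (clamp_ln lo hi a - clamp_ln lo hi b) <= / lo * Rabs (a - b).
  move=> ab; have ra := clamp_range a lohi; have rb := clamp_range b lohi.
  have := clamp_ln_mono a b; rewrite /clamp_ln.
  have := @ln_sub_le (clamp lo hi b) (clamp lo hi a) ltac:(lra) ltac:(lra).
  have := clamp_lipschitz lohi ab; have cm := clamp_mono lo hi ab.
  have : / clamp lo hi a <= / lo by apply: Rinv_le_contravar; lra.
  have : 0 < / clamp lo hi a by apply: Rinv_0_lt_compat; lra.
  rewrite (Rabs_minus_sym a) (Rabs_pos_eq (b - a)); last lra.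
  have := ln_le (clamp lo hi a) (clamp lo hi b) ltac:(lra) cm.
  move=> lnle; rewrite Rabs_minus_sym Rabs_pos_eq; last lra.
  rewrite /Rdiv; move: (/ clamp _ _ _) (/ lo) => p q *; nra.
case: (Rle_dec s t) => st; first exact: W.
by rewrite Rabs_minus_sym (Rabs_minus_sym s); apply: W; lra.
Qed.

Lemma clamp_ln_bound s : Rabs (clamp_ln lo hi s) <= Rabs (ln lo) + Rabs (ln hi).
Proof.
have r := clamp_range s lohi.
have := ln_le lo (clamp lo hi s) lo0 ltac:(lra).
have := ln_le (clamp lo hi s) hi ltac:(lra) ltac:(lra).
rewrite /clamp_ln; move: (ln (clamp _ _ _)) (ln lo) (ln hi) => l p q lq pl.
by apply: Rabs_le; move: (Rle_abs q) (Rle_abs (- p)) (Rabs_pos p) (Rabs_pos q); rewrite Rabs_Ropp; lra.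
Qed.
End ClampLn.

(** Convexity of the squared hinge in the tangent-line form that Klein's inequality takes. *)
Lemma hinge_convex e a b :
  - 2 * Rmax (e - a) 0 * (b - a) <= (Rmax (e - b) 0) ^ 2 - (Rmax (e - a) 0) ^ 2.
Proof.
have -> : b - a = e - a - (e - b) by ring.
move: (e - a) (e - b) => p q; have := pow2_ge_0 (p - q); have := pow2_ge_0 p; have := pow2_ge_0 q.
by rewrite /Rmax; case: (Rle_dec p 0) => hp; case: (Rle_dec q 0) => hq; nra.
Qed.

Lemma hinge_lipschitz e a b : Rabs (- 2 * Rmax (e - a) 0 - - 2 * Rmax (e - b) 0) <= 2 * Rabs (a - b).
Proof.
have -> : - 2 * Rmax (e - a) 0 - - 2 * Rmax (e - b) 0 = 2 * (Rmax (e - b) 0 - Rmax (e - a) 0) by ring.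
rewrite Rabs_mult Rabs_pos_eq; last lra.
apply: Rmult_le_compat_l; first lra.
have := Rmax_lipschitz (e - b) (e - a) 0.
by have -> : e - b - (e - a) = a - b by ring.
Qed.

(* [- ln] continued below [e] by its tangent, so as to be convex on the whole line *)
Definition neg_ln (e s : R) : R := if Rle_dec e s then - ln s else - ln e - (s - e) / e.

(** The two branches have equal slope at [e], so [- / Rmax a e] is the derivative on the whole
    line. *)
Lemma neg_ln_convex e a b : 0 < e -> - / Rmax a e * (b - a) <= neg_ln e b - neg_ln e a.
Proof.
move=> e0; rewrite /neg_ln; case: (Rle_dec e a) => ea; case: (Rle_dec e b) => eb /=.
- rewrite Rmax_left //; have := @ln_sub_le b a ltac:(lra) ltac:(lra); rewrite /Rdiv; lra.
- rewrite Rmax_left //; have := @ln_sub_le e a ltac:(lra) ltac:(lra).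
  have : / a <= / e by apply: Rinv_le_contravar.
  rewrite /Rdiv; have -> : (b - e) * / e = b * / e - 1 by field; lra.
  have -> : (e - a) * / a = e * / a - 1 by field; lra.
  have -> : - / a * (b - a) = - (b * / a) + 1 by field; lra.
  have : e * / e = 1 by field; lra.
  move: (/ a) (/ e) => p q; nra.
- rewrite Rmax_right; last lra.
  have := @ln_sub_le b e ltac:(lra) ltac:(lra); rewrite /Rdiv; lra.
- rewrite Rmax_right; last lra.
  rewrite /Rdiv; lra.
Qed.

Lemma neg_ln_lipschitz e a b : 0 < e ->
  Rabs (- / Rmax a e - - / Rmax b e) <= / e ^ 2 * Rabs (a - b).
Proof.
move=> e0; have ra := Rmax_r a e; have rb := Rmax_r b e.
have -> : - / Rmax a e - - / Rmax b e = (Rmax a e - Rmax b e) * (/ Rmax a e * / Rmax b e).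
  by field; lra.
rewrite Rabs_mult (Rabs_pos_eq (_ * / _)); last first.
  by apply: Rmult_le_pos; apply/Rlt_le/Rinv_0_lt_compat; lra.
rewrite Rmult_comm; apply: Rmult_le_compat; try exact: Rabs_pos.
- by apply: Rmult_le_pos; apply/Rlt_le/Rinv_0_lt_compat; lra.
- have -> : / e ^ 2 = / e * / e by field; lra.
  by apply: Rmult_le_compat; try (apply/Rlt_le/Rinv_0_lt_compat; lra); apply: Rinv_le_contravar.
exact: Rmax_lipschitz.
Qed.

(** [- / a + / b = (a - b) / (a * b)] with [a * b <= M ^ 2] gives two factors [/ M]; the third is
    that of [ln_coercive]. *)
Lemma inv_coercive M a b : 0 < a <= M -> 0 < b <= M ->
  / M ^ 3 * (a - b) ^ 2 <= (- / a - - / b) * (ln a - ln b).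
Proof.
move=> ha hb; have := ln_coercive ha hb.
have -> : - / a - - / b = (a - b) * (/ a * / b) by field; lra.
have -> : / M ^ 3 = / M * (/ M * / M) by field; lra.
have m0 : 0 < / M by apply: Rinv_0_lt_compat; lra.
have am : / M <= / a by apply: Rinv_le_contravar; lra.
have bm : / M <= / b by apply: Rinv_le_contravar; lra.
have ab : / M * / M <= / a * / b by apply: Rmult_le_compat; lra.
have mm : 0 <= / M * / M by nra.
have sq := pow2_ge_0 (a - b); have : 0 <= / M * (a - b) ^ 2 by nra.
move: (/ M * / M) (/ a * / b) mm ab => p q p0 pq X0 Xl.
have h1 := Rmult_le_compat_r _ _ _ X0 pq.
have h2 := Rmult_le_compat_l _ _ _ (Rle_trans _ _ _ p0 pq) Xl.
lra.
Qed.
End RealFunctions.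

(** * Hilbert-Schmidt estimates and real coordinates *)

Lemma hs2_spect n (U : 'M[cpx]_n) f : is_unitary U -> hs2 (spect U f) = \rsum_i (f i) ^ 2.
Proof.
move=> hU; rewrite hs2_ip; last exact: hermitian_spect.
rewrite /ip spectM // mxtrace_spect //=; apply: eq_bigr => i _; ring.
Qed.

Lemma nsqD z w : Rle (nsq (z + w)) (2 * (nsq z + nsq w))%R.
Proof.
rewrite /nsq ReD ImD.
have := pow2_ge_0 (Re z - Re w); have := pow2_ge_0 (Im z - Im w); lra.
Qed.

Lemma hs2D n (a b : 'M[cpx]_n) : Rle (hs2 (a + b)) (2 * (hs2 a + hs2 b))%R.
Proof.
rewrite /hs2 -rsum2D -rsum2M; apply: rsum2_le => i j; rewrite mxE; exact: nsqD.
Qed.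

Lemma hs2_adjoint n (a : 'M[cpx]_n) : hs2 (adjoint a) = hs2 a.
Proof.
rewrite /hs2 rsum_exch; apply: eq_bigr => i _; apply: eq_bigr => j _.
rewrite !mxE /nsq /=; ring.
Qed.

Lemma hs2Z n r (a : 'M[cpx]_n) : hs2 (RtoC r *: a) = (r ^ 2 * hs2 a)%R.
Proof.
rewrite /hs2 -rsum2M; apply: eq_bigr => i _; apply: eq_bigr => j _.
rewrite mxE nsqM /nsq /=; ring.
Qed.

Lemma hs2_entry n (a : 'M[cpx]_n) i j : (nsq (a i j) <= hs2 a)%R.
Proof.
have nn k l : (0 <= nsq (a k l))%R by exact: nsq_ge0.
apply: Rle_trans (_ : \rsum_l nsq (a i l) <= _)%R.
  exact: (rsum_term (F := fun l => nsq (a i l))).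
by apply: (rsum_term (F := fun k => \rsum_l nsq (a k l))) => k; apply: rsum_ge0.
Qed.

Lemma hs2_mcomm_le n (z : 'M[cpx]_n) :
  exists2 C, (0 < C)%R & forall a, (hs2 (mcomm z a) <= C * hs2 a)%R.
Proof.
have [C C0 HC] := rvn_mul (mcomm_mx z); exists C => // a.
by rewrite -!rvn_mxvec -mcomm_mxE.
Qed.

Lemma hs2_lap_le n (x y : 'M[cpx]_n) :
  exists2 C, (0 < C)%R & forall a, (hs2 (lap x y a) <= C * hs2 a)%R.
Proof.
have [A A0 HA] := hs2_mcomm_le x; have [B B0 HB] := hs2_mcomm_le y.
exists (2 * (A * A + B * B))%R => [|a]; first nra.
rewrite lapE; apply: Rle_trans (hs2D _ _) _.
have := HA (mcomm x a); have := Rmult_le_compat_l _ _ _ (Rlt_le _ _ A0) (HA a).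
have := HB (mcomm y a); have := Rmult_le_compat_l _ _ _ (Rlt_le _ _ B0) (HB a).
lra.
Qed.

Lemma mcommB n (z a b : 'M[cpx]_n) : mcomm z (a - b) = mcomm z a - mcomm z b.
Proof.
rewrite /mcomm mulmxBr mulmxBl !opprB.
by rewrite [b *m z - _]addrC addrACA [- (z *m b) + _]addrC.
Qed.

Lemma lapB n (x y a b : 'M[cpx]_n) : lap x y (a - b) = lap x y a - lap x y b.
Proof.
rewrite !lapE (mcommB y a) (mcommB x a) (mcommB y (mcomm y a)) (mcommB x (mcomm x a)).
move: (mcomm y (mcomm y a)) (mcomm y (mcomm y b)) (mcomm x (mcomm x a)) (mcomm x (mcomm x b)) => A B C D.
by rewrite opprD addrACA.
Qed.

Section Coordinates.
Variable n : nat.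
Let I := (bool * ('I_n * 'I_n))%type.

(** Turns the matrix equation into a real system, to which [picard_lindelof] and [ode_unique]
    apply. *)
Definition coords (a : 'M[cpx]_n) (p : I) : R :=
  if p.1 then Re (a p.2.1 p.2.2) else Im (a p.2.1 p.2.2).
Definition of_coords (u : I -> R) : 'M[cpx]_n :=
  \matrix_(i, j) Cpx (u (true, (i, j))) (u (false, (i, j))).

Lemma coordsK : cancel coords of_coords.
Proof. by move=> a; apply/matrixP => i j; rewrite mxE /coords /=; case: (a i j). Qed.

Lemma hs2_coords a : hs2 a = \rsum_p (coords a p) ^ 2.
Proof.
rewrite /hs2 !pair_bigA /= [RHS](eq_bigr (fun p => (fun b q => (coords a (b, q)) ^ 2)%R p.1 p.2)).
  rewrite -(pair_bigA _ (fun b q => (coords a (b, q)) ^ 2)%R) /= big_bool /= -rsumD.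
  by apply: eq_bigr => -[i j] _; rewrite /nsq /coords /=; ring.
by move=> [b q].
Qed.

Lemma coords_le a p K : (0 <= K)%R -> (hs2 a <= K ^ 2)%R -> (Rabs (coords a p) <= K)%R.
Proof.
move=> K0 h; have t : ((coords a p) ^ 2 <= hs2 a)%R.
  by rewrite hs2_coords; apply: (rsum_term (F := fun p => (coords a p) ^ 2)%R) => q; apply: pow2_ge_0.
apply: Rabs_le; split; nra.
Qed.

Lemma hs2_le_l1 (u v : I -> R) :
  Rle (hs2 (of_coords u - of_coords v)) ((\rsum_p Rabs (u p - v p)) ^ 2)%R.
Proof.
rewrite hs2_coords.
have nn p : (0 <= Rabs (u p - v p))%R by exact: Rabs_pos.
set S := \rsum_p Rabs (u p - v p); rewrite [X in (_ <= X)%R](_ : _ = \rsum_p (S * Rabs (u p - v p))).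
  apply: rsum_le => -[b [i j]].
  have -> : coords (of_coords u - of_coords v) (b, (i, j)) = Rminus (u (b, (i, j))) (v (b, (i, j))).
    by case: b; rewrite /coords /= !mxE.
  rewrite -pow2_abs; set r := Rabs _.
  have rS : (r <= S)%R by exact: (rsum_term (F := fun p => Rabs (u p - v p)) (b, (i, j)) nn).
  have r0 : (0 <= r)%R by exact: Rabs_pos.
  nra.
by rewrite rsumM -/S /=; ring.
Qed.

Lemma mderiv_coords (c : R -> 'M[cpx]_n) t D : mderiv c t D <->
  forall p, is_derive (fun s => coords (c s) p) t (coords D p).
Proof.
split=> [cd [[] [i j]]|cd i j]; try by have [] := cd i j.
by split; [exact: (cd (true, (i, j))) | exact: (cd (false, (i, j)))].
Qed.
End Coordinates.

(** A nonexpansive retraction onto the Hermitian matrices; it extends the field to all coordinates,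
    as [fcalc] is meaningful only on Hermitian matrices. *)
Definition herm_part n (a : 'M[cpx]_n) : 'M[cpx]_n := RtoC (/ 2) *: (a + adjoint a).

Lemma adjointZ n r (a : 'M[cpx]_n) : adjoint (RtoC r *: a) = RtoC r *: adjoint a.
Proof.
apply/matrixP => i j; rewrite !mxE rmorphM; congr (_ * _).
by apply: cpx_eq => //=; lra.
Qed.

Lemma hermitianZ n r (a : 'M[cpx]_n) : is_hermitian a -> is_hermitian (RtoC r *: a).
Proof. by rewrite /is_hermitian adjointZ => ->. Qed.

Lemma hermitian_herm_part n (a : 'M[cpx]_n) : is_hermitian (herm_part a).
Proof. by apply: hermitianZ; rewrite /is_hermitian adjointD adjointK addrC. Qed.

Lemma herm_part_id n (a : 'M[cpx]_n) : is_hermitian a -> herm_part a = a.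
Proof.
move=> ha; rewrite /herm_part ha -[a in _ *: (a + _)]scale1r -[a in _ + a]scale1r -scalerDl scalerA.
by rewrite (_ : _ * _ = 1) ?scale1r //; apply: cpx_eq; rewrite /=; lra.
Qed.

Lemma herm_partB n (a b : 'M[cpx]_n) : herm_part a - herm_part b = herm_part (a - b).
Proof. by rewrite /herm_part -scalerBr adjointB opprD addrACA. Qed.

Lemma hs2_herm_part n (a : 'M[cpx]_n) : (hs2 (herm_part a) <= hs2 a)%R.
Proof.
rewrite /herm_part hs2Z; have := hs2D a (adjoint a); rewrite hs2_adjoint; lra.
Qed.

Lemma coordsB n (a b : 'M[cpx]_n) p : coords (a - b) p = Rminus (coords a p) (coords b p).
Proof. by case: p => -[] [i j]; rewrite /coords /= !mxE. Qed.

Lemma nsqN z : nsq (- z) = nsq z.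
Proof. rewrite /nsq ReN ImN; ring. Qed.

Lemma hs2N n (a : 'M[cpx]_n) : hs2 (- a) = hs2 a.
Proof. by apply: eq_bigr => i _; apply: eq_bigr => j _; rewrite mxE nsqN. Qed.

(** * The truncated equation as a bounded Lipschitz system *)

Section ClampedFlow.
Variables (n : nat) (x y : 'M[cpx]_n) (lo hi : R).
Hypotheses (hx : is_hermitian x) (hy : is_hermitian y).
Hypotheses (lo0 : (0 < lo)%R) (lohi : (lo <= hi)%R).

Definition clamped_field (a : 'M[cpx]_n) : 'M[cpx]_n := - lap x y (fcalc (clamp_ln lo hi) a).

(** Hermitian at all real times, because the two-sided derivative in [is_derive_ftrace] also looks
    left of [t0]. *)
Definition clamped_flow (t0 : R) (c : R -> 'M[cpx]_n) : Prop :=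
  (forall s, is_hermitian (c s)) /\
  (forall t, (t0 <= t)%R -> mderiv c t (clamped_field (c t))).

Lemma hermitian_clamped_field a : is_hermitian (clamped_field a).
Proof. by apply: hermitianN; apply: hermitian_lap => //; apply: hermitian_fcalc. Qed.

Let G u := coords (clamped_field (herm_part (of_coords u))).

Lemma clamped_field_lipschitz :
  exists2 K, (0 <= K)%R & forall u v p, (Rabs (G u p - G v p) <= K * \rsum_q Rabs (u q - v q))%R.
Proof.
have [C C0 HC] := hs2_lap_le x y.
(* [C] bounds the Laplacian in squared norm, hence the root; [/ lo] is the Lipschitz constant of the
   truncated logarithm. *)
exists (sqrt C * / lo)%R => [|u v p].
  by apply: Rmult_le_pos; [exact: sqrt_pos | exact/Rlt_le/Rinv_0_lt_compat].
rewrite /G -coordsB; apply: coords_le.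
  apply: Rmult_le_pos; last by apply: rsum_ge0 => q; exact: Rabs_pos.
  by apply: Rmult_le_pos; [exact: sqrt_pos | exact/Rlt_le/Rinv_0_lt_compat].
set a := herm_part (of_coords u); set b := herm_part (of_coords v).
have -> : clamped_field a - clamped_field b =
    - lap x y (fcalc (clamp_ln lo hi) a - fcalc (clamp_ln lo hi) b).
  by rewrite lapB opprB opprK addrC.
rewrite hs2N.
have h1 := HC (fcalc (clamp_ln lo hi) a - fcalc (clamp_ln lo hi) b).
have h2 := fcalc_lip (hermitian_herm_part (of_coords u)) (hermitian_herm_part (of_coords v))
  (clamp_ln_lipschitz lo0 lohi).
have h3 : Rle (hs2 (a - b)) (hs2 (of_coords u - of_coords v)).
  by rewrite /a /b herm_partB; exact: hs2_herm_part.
have h4 := hs2_le_l1 u v.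
apply: Rle_trans h1 _; rewrite !Rpow_mult_distr pow2_sqrt; last lra.
rewrite Rmult_assoc; apply: Rmult_le_compat_l; first lra.
apply: Rle_trans h2 _; apply: Rmult_le_compat_l; first exact: pow2_ge_0.
exact: Rle_trans h3 h4.
Qed.

Lemma clamped_field_bound : exists B, forall u p, (Rabs (G u p) <= B)%R.
Proof.
have [C C0 HC] := hs2_lap_le x y.
set b := (Rabs (ln lo) + Rabs (ln hi))%R.
have N0 := pos_INR n; have b2 := pow2_ge_0 b.
exists (sqrt (C * (INR n * b ^ 2)))%R => u p; apply: coords_le; first exact: sqrt_pos.
rewrite pow2_sqrt; last by apply: Rmult_le_pos; [lra | exact: Rmult_le_pos].
rewrite hs2N; apply: Rle_trans (HC _) _; apply: Rmult_le_compat_l; first lra.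
have [hU _] := diagonalizationP (hermitian_herm_part (of_coords u)).
rewrite /fcalc hs2_spect //.
have -> : (INR n * b ^ 2)%R = \big[Rplus/IZR 0]_(i < n) (b ^ 2)%R by rewrite rsum_const card_ord.
apply: rsum_le => i.
rewrite -pow2_abs; apply: pow_incr; split; first exact: Rabs_pos.
exact: clamp_ln_bound.
Qed.

Lemma clamped_flow_exists t0 c0 : is_hermitian c0 ->
  exists2 c, c t0 = c0 & clamped_flow t0 c.
Proof.
move=> h0; have [K K0 HK] := clamped_field_lipschitz; have [B HB] := clamped_field_bound.
have [w [w0 wd]] := picard_lindelof K0 HK HB t0 (coords c0).
pose c t : 'M[cpx]_n := of_coords (w t).
have ct0 : c t0 = c0.
  rewrite /c (_ : w t0 = coords c0) ?coordsK //; exact: functional_extensionality.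
have cw s p : coords (c s) p = w s p.
  by case: p => -[] [i j]; rewrite /coords /= mxE.
have cd t : mderiv c t (clamped_field (herm_part (c (Rmax t t0)))).
  apply/mderiv_coords => p; apply: (is_derive_ext (fun s => w s p)) => [s|]; first by rewrite cw.
  exact: wd.
clearbody c.
have const (f : R -> R) s : (forall t, is_derive f t (0%R : R)) -> f s = f t0.
  move=> fd; case: (Rle_dec t0 s) => ts; first by apply: derive_eq0_const ts => t _.
  by apply/esym; apply: (derive_eq0_const (t0 := s)) => [t _|]; [exact: fd | lra].
(* The field has Hermitian values, so the entries of [adjoint (c s) - c s] have derivative zero on
   the whole line and vanish at [t0]. *)
have hc s : is_hermitian (c s).
  apply/matrixP => i j; rewrite !mxE.
  have conj_sym a : is_hermitian a -> Cconj (a j i) = a i j.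
    by move=> ha; move/matrixP: ha => /(_ i j); rewrite !mxE.
  have h0ij := conj_sym _ h0; apply: cpx_eq => /=; apply: Rminus_diag_uniq.
    rewrite (const (fun s => Re (c s j i) - Re (c s i j))%R) => [|t].
      by rewrite ct0 -h0ij /=; lra.
    have [re _] := cd t i j; have [re' _] := cd t j i.
    have := is_derive_minus _ _ _ _ _ re' re.
    by rewrite -(conj_sym _ (hermitian_clamped_field _)) /minus /plus /opp /= Rplus_opp_r.
  rewrite (const (fun s => - Im (c s j i) - Im (c s i j))%R) => [|t].
    by rewrite ct0 -h0ij /=; lra.
  have [_ im] := cd t i j; have [_ im'] := cd t j i.
  have := is_derive_minus _ _ _ _ _ (is_derive_opp _ _ _ im') im.
  by rewrite -(conj_sym _ (hermitian_clamped_field _)) /minus /plus /opp /= Rplus_opp_r.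
exists c; first exact: ct0.
split=> [|t tt]; first exact: hc.
by have := cd t; rewrite (Rmax_left _ _ tt) (herm_part_id (hc t)).
Qed.

Lemma clamped_flow_unique t0 t1 c c' : clamped_flow t0 c -> clamped_flow t0 c' ->
  (t0 <= t1)%R -> c t1 = c' t1 -> forall t, (t0 <= t)%R -> c t = c' t.
Proof.
move=> [hc cd] [hc' cd'] t01 E t tt; have [K K0 HK] := clamped_field_lipschitz.
apply: (can_inj (@coordsK n)); apply: functional_extensionality => p.
have GE s a : is_hermitian a -> G (coords a) s = coords (clamped_field a) s.
  by move=> ha; rewrite /G coordsK herm_part_id.
apply: (@ode_unique _ G K t0 t1 (fun s => coords (c s)) (fun s => coords (c' s))) => //.
- by move=> s q ss; rewrite GE //; apply/mderiv_coords: q; exact: cd.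
- by move=> s q ss; rewrite GE //; apply/mderiv_coords: q; exact: cd'.
by move=> q; rewrite E.
Qed.
End ClampedFlow.

(** * Dissipation *)

Lemma nondecr_comonotone (g : R -> R) p q r : (forall s t, s <= t -> g s <= g t)%R ->
  (0 <= (p - q) * r)%R -> (0 <= (g p - g q) * r)%R.
Proof.
move=> gm pqr; case: (Rtotal_order p q) => [lt|[->|gt]].
- by have := gm p q (Rlt_le _ _ lt); nra.
- by rewrite Rminus_diag; lra.
by have := gm q p (Rlt_le _ _ gt); nra.
Qed.

Section Dissipation.
Variables (n : nat) (x y : 'M[cpx]_n) (t0 : R) (c : R -> 'M[cpx]_n).
Hypotheses (hx : is_hermitian x) (hy : is_hermitian y).
Hypothesis hc : forall s, is_hermitian (c s).
(** Covers both flows: [e] will be the logarithm of [d] or its truncation, each ordered like [d]. *)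
Hypothesis cd : forall t, (t0 <= t)%R -> exists U d e,
  [/\ is_unitary U, c t = spect U d, forall i j, (0 <= (d i - d j) * (e i - e j))%R &
      mderiv c t (- lap x y (spect U e))].

Lemma flow_trace t : (t0 <= t)%R -> \tr (c t) = \tr (c t0).
Proof.
have D s : (t0 <= s)%R -> is_derive (fun s => Re (\tr (c s))) s (0%R : R) /\
                         is_derive (fun s => Im (\tr (c s))) s (0%R : R).
  move=> ss; have [U [d [e [_ _ _ /is_derive_trace]]]] := cd ss.
  by rewrite mxtraceN mxtrace_lap oppr0.
move=> tt; apply: cpx_eq.
  by apply: (derive_eq0_const (f := fun s => Re (\tr (c s)))) tt => s /D [].
by apply: (derive_eq0_const (f := fun s => Im (\tr (c s)))) tt => s /D [].
Qed.

(* [tr (max (lo - c) 0)^2] vanishes at [t0] and cannot increase. *)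
Lemma flow_lower_bound lo U0 d0 : is_unitary U0 -> c t0 = spect U0 d0 ->
  (forall i, (lo <= d0 i)%R) ->
  forall t U d, (t0 <= t)%R -> is_unitary U -> c t = spect U d -> forall i, (lo <= d i)%R.
Proof.
move=> hU0 E0 lo0 t U d tt hU Et i.
pose f s := ((Rmax (lo - s) 0) ^ 2)%R; pose g s := (- 2 * Rmax (lo - s) 0)%R.
have dec : (ftrace f (c t) <= ftrace f (c t0))%R.
  apply: (derive_le0_decr (f := fun s => ftrace f (c s)) _ (Rle_refl t0) tt) => s ss.
  have [V [l [e [hV Es le D]]]] := cd ss.
  exists (ip (fcalc g (c s)) (- lap x y (spect V e))).
    exact: (is_derive_ftrace (hinge_convex lo) (hinge_lipschitz lo) hc D).
  rewrite ipNr Es fcalcE //.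
  (* With coercivity constant 0, only the monotonicity of [g] and the common ordering of [l] and [e]
     enter. *)
  have := @ip_lap n x y V l 0%R (fun i => g (l i)) e hx hy hV.
  suff h : forall i j, (0 * (l i - l j) ^ 2 <= (g (l i) - g (l j)) * (e i - e j))%R.
    by move=> /(_ h); lra.
  move=> k m; rewrite Rmult_0_l; apply: nondecr_comonotone (le k m) => p q pq.
  by have := Rle_max_compat_r (lo - q) (lo - p) 0 ltac:(lra); rewrite /g; lra.
have T0 : ftrace f (c t0) = 0%R.
  rewrite E0 ftraceE // (eq_bigr (fun=> 0%R)) ?rsum_const; first lra.
  by move=> k _; rewrite /f Rmax_right; [lra | have := lo0 k; lra].
move: dec; rewrite T0 Et ftraceE // => /(rsum_eq0 (F := fun k => f (d k)) (fun k => pow2_ge_0 _)) /(_ i).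
rewrite /f; have := Rmax_l (lo - d i) 0; nra.
Qed.

(** Positive eigenvalues are at most their sum, and the trace is conserved. *)
Lemma flow_spectrum lo U0 d0 : is_unitary U0 -> c t0 = spect U0 d0 ->
  (0 < lo)%R -> (forall i, (lo <= d0 i)%R) ->
  forall t U d, (t0 <= t)%R -> is_unitary U -> c t = spect U d ->
  forall i, (lo <= d i <= Re (\tr (c t0)))%R.
Proof.
move=> hU0 E0 lo0 lod t U d tt hU Et i.
have ge k : (lo <= d k)%R by exact: (flow_lower_bound hU0 E0 lod tt hU Et).
split=> //; rewrite -(flow_trace tt) Et mxtrace_spect //=.
by apply: (rsum_term (F := d)) => k; have := ge k; lra.
Qed.
End Dissipation.

(** * Positivity, logarithm and determinant in an eigenbasis *)

Section Positivity.
Variable n : nat.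
Implicit Types (U c L : 'M[cpx]_n) (d : 'I_n -> R).

(** The columns of [U] are eigenvectors for the [d i]; conversely a nonzero coordinate [i] of
    [adjoint U *m v] identifies [lam] with [d i]. *)
Lemma strictly_pos_spect U d : is_unitary U ->
  strictly_pos (spect U d) <-> forall i, (0 < d i)%R.
Proof.
move=> hU; split=> [[_ H] i|d0].
  pose w : 'cV[cpx]_n := delta_mx i 0.
  have w0 : w != 0.
    by apply/eqP => /matrixP /(_ i 0); rewrite !mxE !eqxx => -[]; apply: R1_neq_R0.
  have v0 : U *m w != 0.
    by apply/eqP => E; move/eqP: w0; apply; rewrite -[w]mul1mx -hU -mulmxA E mulmx0.
  have Dw : rdiag d *m w = RtoC (d i) *: w.
    apply/matrixP => k l; rewrite /rdiag mul_diag_mx !mxE.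
    by case: eqVneq => [->|_] //=; rewrite ?mulr0.
  suff E : spect U d *m (U *m w) = RtoC (d i) *: (U *m w) by have [] := H _ _ v0 E.
  by rewrite /spect -!mulmxA (mulmxA (adjoint U)) hU mul1mx Dw scalemxAr.
split; first exact: hermitian_spect.
move=> lam v v0 E; pose w := adjoint U *m v.
have w0 : w != 0.
  by apply/eqP => E0; move/eqP: v0; apply; rewrite -[v]mul1mx -(unitaryV hU) -mulmxA -/w E0 mulmx0.
have Ew : rdiag d *m w = lam *: w.
  by rewrite /w scalemxAr -E /spect !mulmxA hU mul1mx.
have [i wi] : exists i, w i 0 != 0.
  apply/existsP; rewrite -negb_forall; apply: contra w0 => /forallP w0.
  by apply/eqP/matrixP => i j; rewrite ord1 [RHS]mxE; apply/eqP; exact: w0 i.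
clearbody w; move/matrixP: Ew => /(_ i 0); rewrite /rdiag mul_diag_mx !mxE => /(mulIf wi) <- /=.
by split=> //; exact: d0.
Qed.

(** The relation [is_log] has at most one value, so the equation can be stated with [fcalc ln]. *)
Lemma is_log_fcalc c L : is_log c L -> L = fcalc ln c.
Proof. by move=> [U [d [hU [_ [-> ->]]]]]; rewrite -/(rdiag _) -/(spect U d) fcalcE. Qed.

Lemma is_log_spect U d : is_unitary U -> (forall i, (0 < d i)%R) ->
  is_log (spect U d) (spect U (fun i => ln (d i))).
Proof. by move=> hU d0; exists U, d. Qed.

Lemma spect_const U r : is_unitary U -> spect U (fun=> r) = (RtoC r)%:M.
Proof.
move=> hU; rewrite /spect /rdiag (_ : diag_mx _ = (RtoC r)%:M); last first.
  by rewrite -diag_const_mx; congr diag_mx; apply/rowP => i; rewrite !mxE.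
by rewrite mul_mx_scalar -scalemxAl unitaryV // scalemx1.
Qed.

Lemma unitary1 : is_unitary (1%:M : 'M[cpx]_n).
Proof. by rewrite /is_unitary mulmx1 adjoint1. Qed.

Lemma det_spect U d : is_unitary U -> \det (spect U d) = \prod_i RtoC (d i).
Proof.
move=> hU; rewrite /spect !det_mulmx mulrC mulrA -det_mulmx hU det1 mul1r.
by rewrite /rdiag det_diag; apply: eq_bigr => i _; rewrite mxE.
Qed.

Lemma prod_exp_ln d : (forall i, (0 < d i)%R) ->
  \prod_i RtoC (d i) = RtoC (exp (\rsum_i ln (d i))).
Proof.
move=> d0; elim/big_rec2: _ => [|i a b _ ->]; first by rewrite exp_0.
by rewrite exp_plus exp_ln // RtoCM.
Qed.
End Positivity.

(** * From one-sided to two-sided derivatives *)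

Section OneSided.
Local Open Scope R_scope.

Lemma derive_within (f : R -> R) l t0 t : is_derive f t l ->
  limit1_in (fun s => (f s - f t) / (s - t)) (fun s => t0 <= s /\ s <> t) l t.
Proof.
move=> /is_derive_Reals fd eps eps0; have [del Hd] := fd eps eps0.
exists del; split; first exact: (cond_pos del).
move=> s [[_ st] ds]; rewrite /dist /= /R_dist in ds *.
have := Hd (s - t) ltac:(lra) ds.
by have -> : t + (s - t) = s by ring.
Qed.

(* Continuing [f] affinely to the left of [t0] makes its derivative at [t0] two-sided. *)
Lemma derive_left_affine (f : R -> R) l l0 t0 t : t0 <= t -> (t = t0 -> l = l0) ->
  limit1_in (fun s => (f s - f t) / (s - t)) (fun s => t0 <= s /\ s <> t) l t ->
  is_derive (fun s => if Rle_dec t0 s then f s else f t0 + (s - t0) * l0) t l.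
Proof.
move=> tt ll lim; apply/is_derive_Reals => eps eps0.
have [a [a0 Ha]] := lim eps eps0.
(* For [t > t0] the radius also keeps [t + h] to the right of [t0]. *)
pose b := if Rle_dec t t0 then a else Rmin a (t - t0).
have b0 : 0 < b by rewrite /b; case: Rle_dec => //= h; apply: Rmin_glb_lt; lra.
exists (mkposreal b b0) => h h0 /= hb.
case: (Rle_dec t0 t) => //= _; case: (Rle_dec t0 (t + h)) => /= th; last first.
  (* A point left of [t0] is in reach only from [t0] itself, where the affine part has difference
     quotient exactly [l0]. *)
  have tE : t = t0.
    move: hb; rewrite /b; case: Rle_dec => /= ?; first lra.
    by move=> /Rlt_le_trans /(_ (Rmin_r _ _)); have := Rle_abs (- h); rewrite Rabs_Ropp; lra.
  rewrite (ll tE) tE.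
  have -> : (f t0 + (t0 + h - t0) * l0 - f t0) / h - l0 = 0 by field.
  by rewrite Rabs_R0.
have := Ha (t + h); rewrite /dist /= /R_dist.
have -> : t + h - t = h by ring.
apply; split; first by split; lra.
apply: Rlt_le_trans hb _; rewrite /b; case: Rle_dec => /= _; [lra | exact: Rmin_l].
Qed.
End OneSided.

Lemma mderiv_within n (c : R -> 'M[cpx]_n) t0 t D : mderiv c t D -> deriv_within t0 c t D.
Proof.
move=> cd i j; have [re im] := cd i j.
by split; [apply: (derive_within (f := fun s => Re (c s i j))) | apply: (derive_within (f := fun s => Im (c s i j)))].
Qed.

(** Continues [c] affinely left of [t0] with its initial velocity. That velocity is Hermitian, so
    the continuation is Hermitian at all times; positivity is claimed only from [t0] on. *)
Lemma ricci_solution_extend n (x y : 'M[cpx]_n) t0 c0 c :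
  is_hermitian x -> is_hermitian y -> ricci_solution x y t0 c0 c ->
  exists2 c', forall t, (t0 <= t)%R -> c' t = c t &
    (forall s, is_hermitian (c' s)) /\
    forall t, (t0 <= t)%R -> exists U d, [/\ is_unitary U, c' t = spect U d,
      forall i, (0 < d i)%R & mderiv c' t (- lap x y (spect U (fun i => ln (d i))))].
Proof.
move=> hx hy [ct0 sol].
pose D0 := - lap x y (fcalc ln (c t0)).
pose c' s := if Rle_dec t0 s then c s else c t0 + RtoC (s - t0)%R *: D0.
have c'E t : (t0 <= t)%R -> c' t = c t by rewrite /c'; case: Rle_dec.
have hD0 : is_hermitian D0.
  by apply: hermitianN; apply: hermitian_lap => //; apply: hermitian_fcalc.
exists c' => //; split=> [s|t tt].
  rewrite /c'; case: Rle_dec => /= ts; first by have [[]] := sol s ts.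
  apply: hermitianD; last exact: hermitianZ.
  by have [[]] := sol t0 (Rle_refl _).
have [pos D] := sol t tt; have [hU E] := diagonalizationP (proj1 pos).
move: hU E; move: (diagonalization (c t)) => [U d] /= hU E.
have d0 : forall i, (0 < d i)%R by apply/(strictly_pos_spect _ hU); rewrite -E.
exists U, d; split => //; first by rewrite c'E.
have := D _ _; rewrite {1}E => /(_ _ (is_log_spect hU d0)) cd.
have DE : t = t0 -> - lap x y (spect U (fun i => ln (d i))) = D0.
  by move=> tE; rewrite /D0 -tE E (fcalcE ln d hU); reflexivity.
move: (- lap _ _ _) cd DE => A cd DE; clearbody D0.
move=> i j; have [re im] := cd i j; split.
  apply: (is_derive_ext (fun s => if Rle_dec t0 s then Re (c s i j) else (Re (c t0 i j) + (s - t0) * Re (D0 i j))%R)).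
    by move=> s; rewrite /c'; case: Rle_dec => //= _; rewrite !mxE ReD ReM /=; lra.
  by apply: (derive_left_affine (f := fun s => Re (c s i j))) => // tE; rewrite DE.
apply: (is_derive_ext (fun s => if Rle_dec t0 s then Im (c s i j) else (Im (c t0 i j) + (s - t0) * Im (D0 i j))%R)).
  by move=> s; rewrite /c'; case: Rle_dec => //= _; rewrite !mxE ImD ImM /=; lra.
by apply: (derive_left_affine (f := fun s => Im (c s i j))) => // tE; rewrite DE.
Qed.

(** * The Ricci flow *)

Lemma spectB n (U : 'M[cpx]_n) f g :
  spect U f - spect U g = spect U (fun i => f i - g i)%R.
Proof.
rewrite /spect -mulmxBl -mulmxBr; congr (_ *m _ *m _).
rewrite /rdiag -raddfB; congr diag_mx; apply/rowP => i; rewrite !mxE.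
by apply: cpx_eq => /=; lra.
Qed.

Lemma mcomm_scalar n (z : 'M[cpx]_n) b : mcomm z b%:M = 0.
Proof. by rewrite /mcomm scalar_mxC subrr. Qed.

Lemma lap_scalar n (x y : 'M[cpx]_n) b : lap x y b%:M = 0.
Proof.
have z0 z : mcomm z (0 : 'M[cpx]_n) = 0 by rewrite /mcomm mulmx0 mul0mx subrr.
by rewrite lapE !mcomm_scalar !z0 addr0.
Qed.

Section RicciFlow.
Variables (n : nat) (x y : 'M[cpx]_n).
Hypotheses (n0 : (0 < n)%N) (hx : is_hermitian x) (hy : is_hermitian y).
Variables (t0 : R) (U0 : 'M[cpx]_n) (d0 : 'I_n -> R) (lo : R).
Hypotheses (hU0 : is_unitary U0) (lo0 : (0 < lo)%R) (lod : forall i, (lo <= d0 i)%R).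

(** The trace of [c0], used as the upper truncation level. *)
Let M := \rsum_i d0 i.
Let c0 := spect U0 d0.
Let mu := (/ INR n * M)%R.

Lemma lo_le_trace : (lo <= M)%R.
Proof.
apply: Rle_trans (lod (Ordinal n0)) _.
by apply: rsum_term => i; have := lod i; lra.
Qed.

Lemma trace_gt0 : (0 < M)%R. Proof. by have := lo_le_trace; lra. Qed.

Lemma mean_c0 : mean c0 = RtoC mu.
Proof. by rewrite /mean mxtrace_spect // -RtoCM. Qed.

Section Solution.
Variable c : R -> 'M[cpx]_n.
Hypotheses (ct0 : c t0 = c0) (cflow : clamped_flow x y lo M t0 c).

Let hc s : is_hermitian (c s). Proof. by case: cflow. Qed.

Lemma clamped_dissipation t : (t0 <= t)%R -> exists U d e,
  [/\ is_unitary U, c t = spect U d, forall i j, (0 <= (d i - d j) * (e i - e j))%R &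
      mderiv c t (- lap x y (spect U e))].
Proof.
move=> tt; have [hU E] := diagonalizationP (hc t).
exists (diagonalization (c t)).1, (diagonalization (c t)).2,
  (fun i => clamp_ln lo M ((diagonalization (c t)).2 i)); split=> //.
  by move=> i j; apply: clamp_ln_mono => //; exact: lo_le_trace.
exact: (proj2 cflow).
Qed.

Lemma clamped_spectrum t U d : (t0 <= t)%R -> is_unitary U -> c t = spect U d ->
  forall i, (lo <= d i <= M)%R.
Proof.
move=> tt hU E i.
have := flow_spectrum hx hy hc clamped_dissipation hU0 ct0 lo0 lod tt hU E i.
by rewrite ct0 mxtrace_spect.
Qed.

Lemma clamped_trace t : (t0 <= t)%R -> \tr (c t) = \tr c0.
Proof. by move=> tt; rewrite (flow_trace clamped_dissipation tt) ct0. Qed.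

(** The spectrum stays between [lo] and [M], where the truncation is the identity. *)
Lemma clamped_fcalc t : (t0 <= t)%R -> fcalc (clamp_ln lo M) (c t) = fcalc ln (c t).
Proof.
move=> tt; have [hU E] := diagonalizationP (hc t).
rewrite /fcalc; congr spect; apply: functional_extensionality => i.
by rewrite /clamp_ln clamp_id //; exact: clamped_spectrum E i.
Qed.

Lemma clamped_mderiv t : (t0 <= t)%R -> mderiv c t (- lap x y (fcalc ln (c t))).
Proof. by move=> tt; rewrite -clamped_fcalc //; exact: (proj2 cflow). Qed.

Lemma clamped_ricci_solution : ricci_solution x y t0 c0 c.
Proof.
split=> // t tt; have [hU E] := diagonalizationP (hc t); split.
  rewrite E; apply/(strictly_pos_spect _ hU) => i.
  by have := clamped_spectrum tt hU E i; lra.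
move=> L /is_log_fcalc ->; apply: mderiv_within; exact: clamped_mderiv.
Qed.

Lemma ftrace_derive f g K t U d : (forall s t, g s * (t - s) <= f t - f s)%R ->
  (forall s t, Rabs (g s - g t) <= K * Rabs (s - t))%R ->
  (t0 <= t)%R -> is_unitary U -> c t = spect U d ->
  is_derive (fun s => ftrace f (c s)) t
    (- ip (spect U (fun i => g (d i))) (lap x y (spect U (fun i => ln (d i)))))%R.
Proof.
move=> fg gK tt hU E.
have := is_derive_ftrace fg gK hc (clamped_mderiv tt).
by rewrite ipNr E !(fcalcE _ d hU).
Qed.

Lemma hs2_dist (U : 'M[cpx]_n) d : is_unitary U -> hs2 (spect U d - (mean c0)%:M) = \rsum_i (d i - mu) ^ 2.
Proof. by move=> hU; rewrite mean_c0 -(spect_const mu hU) spectB hs2_spect. Qed.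

Variable C : R.
Hypothesis C0 : (0 < C)%R.
Hypothesis gap : forall a, (hs2 (a - (mean a)%:M) <= C * energy x y a)%R.

Lemma gap_at t : (t0 <= t)%R -> (hs2 (c t - (mean c0)%:M) <= C * energy x y (c t))%R.
Proof. by move=> tt; have := gap (c t); rewrite /mean clamped_trace. Qed.

(** The 2 comes from differentiating the square, [/ M] from [ln_coercive], [/ C] from the spectral
    gap. *)
Let k := (2 / M / C)%R.

(** The squared distance to the mean has derivative at most [- k] times itself, so its product with
    the exponential is nonincreasing. *)
Lemma exp_decay t : (t0 <= t)%R ->
  (hs2 (c t - (mean c0)%:M) * exp (k * (t - t0)) <= hs2 (c0 - (mean c0)%:M))%R.
Proof.
move=> tt; have M0 := trace_gt0.
have dist s : (t0 <= s)%R -> hs2 (c s - (mean c0)%:M) = ftrace (fun r => (r - mu) ^ 2)%R (c s).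
  move=> ss; have [hU E] := diagonalizationP (hc s).
  by rewrite {1}E hs2_dist.
have := @derive_le0_decr (fun s => ftrace (fun r => (r - mu) ^ 2)%R (c s) * (1 * exp (k * (s - t0))))%R t0.
move=> /(_ _ t0 t (Rle_refl t0) tt).
rewrite -dist // -dist; last exact: Rle_refl.
rewrite ct0 Rminus_diag Rmult_0_r exp_0 !Rmult_1_r Rmult_1_l; apply => s ss.
have [hU E] := diagonalizationP (hc s); move: hU E.
move: (diagonalization (c s)) => [U d] /= hU E.
have fd := @ftrace_derive (fun r => (r - mu) ^ 2)%R (fun r => 2 * (r - mu))%R 2 s U d _ _ ss hU E.
set D := (- ip _ _)%R in fd.
exists (D * (1 * exp (k * (s - t0))) + ftrace (fun r => (r - mu) ^ 2)%R (c s) * (1 * (k * exp (k * (s - t0)))))%R.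
  apply: (is_derive_mult (fun s => ftrace (fun r => (r - mu) ^ 2)%R (c s)) (fun s => 1 * exp (k * (s - t0)))%R).
  - apply: fd => a b; first by have := pow2_ge_0 (a - b); lra.
    rewrite -Rmult_minus_distr_l Rabs_mult (Rabs_pos_eq 2); last lra.
    by apply: Req_le; congr (_ * Rabs _)%R; ring.
  - exact: is_derive_expl.
  by move=> *; exact: Rmult_comm.
have sp := clamped_spectrum ss hU E.
have diss : (2 / M * energy x y (c s) <= - D)%R.
  rewrite /D E Ropp_involutive; apply: ip_lap => // i j.
  have := @ln_coercive M (d i) (d j) ltac:(have := sp i; lra) ltac:(have := sp j; lra).
  rewrite /Rdiv; lra.
have : (k * ftrace (fun r => (r - mu) ^ 2)%R (c s) <= 2 / M * energy x y (c s))%R.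
  rewrite -dist // /k; have := gap_at ss.
  have kp : (0 < 2 / M / C)%R by apply: Rdiv_lt_0_compat => //; apply: Rdiv_lt_0_compat; lra.
  move/(Rmult_le_compat_l _ _ _ (Rlt_le _ _ kp)).
  by have -> : (2 / M / C * (C * energy x y (c s)) = 2 / M * energy x y (c s))%R by field; lra.
have := exp_pos (k * (s - t0)).
move: (exp _) (ftrace _ _) (_ * energy _ _ _)%R diss => e T X diss e0 kT.
have : (0 <= (- D - k * T) * e)%R by apply: Rmult_le_pos; lra.
lra.
Qed.

Lemma convergence : mat_lim_infty c (mean c0)%:M.
Proof.
move=> eps eps0; have M0 := trace_gt0.
set V0 := hs2 (c0 - (mean c0)%:M).
have V00 : (0 <= V0)%R by exact: hs2_ge0.
have k0 : (0 < k)%R by apply: Rdiv_lt_0_compat => //; apply: Rdiv_lt_0_compat; lra.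
have e2 : (0 < eps ^ 2)%R by apply: pow_lt.
(* Chosen for the bound [1 + r <= exp r]: beyond this time a squared distance of [eps ^ 2] or more
   would contradict [exp_decay]. *)
exists (t0 + V0 / (k * eps ^ 2))%R => t tt i j.
have ke : (0 < k * eps ^ 2)%R by apply: Rmult_lt_0_compat.
have q0 : (0 <= V0 / (k * eps ^ 2))%R by apply: Rdiv_le_0_compat.
have t0t : (t0 <= t)%R by lra.
have small : (hs2 (c t - (mean c0)%:M) < eps ^ 2)%R.
  have := exp_decay t0t; rewrite -/V0; set V := hs2 _.
  have Vp : (0 <= V)%R by exact: hs2_ge0.
  have := exp_ineq1_le (k * (t - t0)).
  have : (V0 <= k * eps ^ 2 * (t - t0))%R.
    have -> : V0 = (k * eps ^ 2 * (V0 / (k * eps ^ 2)))%R by field; lra.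
    by apply: Rmult_le_compat_l; lra.
  move: (exp _) => e h1 h2 h3.
  apply: Rnot_le_lt => ge.
  have : (eps ^ 2 * (1 + k * (t - t0)) <= V * e)%R.
    have kt : (0 <= k * (t - t0))%R by apply: Rmult_le_pos; lra.
    by apply: Rmult_le_compat; lra.
  lra.
have ent : Rle (nsq (c t i j - (mean c0)%:M i j)) (hs2 (c t - (mean c0)%:M)).
  by apply: Rle_trans (hs2_entry _ i j); move: (c t) (_%:M) => A B; rewrite !mxE; exact: Rle_refl.
move: (c t i j) (_%:M i j) (hs2 _) ent small => z w h; rewrite /nsq ReB ImB => ent small.
have b r s : (r * r + s * s < eps ^ 2)%R -> (Rabs r < eps)%R.
  by move=> lt; apply: Rabs_def1; nra.
by split; [apply: (b _ (Im z - Im w)%R) | apply: (b _ (Re z - Re w)%R)]; lra.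
Qed.

(** The truncated logarithm of a scalar matrix is scalar, hence annihilated by the Laplacian. *)
Lemma const_clamped_flow : clamped_flow x y lo M t0 (fun=> (mean c0)%:M).
Proof.
rewrite mean_c0; split=> [s|t tt].
  by rewrite -(spect_const _ (@unitary1 n)); exact: hermitian_spect.
rewrite /clamped_field -(spect_const mu (@unitary1 n)) (fcalcE _ _ (@unitary1 n)).
rewrite (spect_const (clamp_ln lo M mu) (@unitary1 n)) lap_scalar oppr0.
by move=> i j; rewrite [(0 : 'M_n) i j]mxE; split; exact: is_derive_const.
Qed.

(** Uniqueness against the constant flow, with agreement imposed at [t1]; times [t] before [t1] are
    included. *)
Lemma scalar_propagates t1 : (t0 <= t1)%R -> c t1 = (mean c0)%:M ->
  forall t, (t0 <= t)%R -> c t = (mean c0)%:M.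
Proof.
move=> tt1 E t tt.
exact: (clamped_flow_unique lo0 lo_le_trace cflow const_clamped_flow tt1 E tt).
Qed.

Lemma det_clamped t : (t0 <= t)%R -> \det (c t) = RtoC (exp (- ftrace (neg_ln lo) (c t))).
Proof.
move=> tt; have [hU E] := diagonalizationP (hc t).
have sp := clamped_spectrum tt hU E.
rewrite {1}E det_spect // prod_exp_ln; last by move=> i; have := sp i; lra.
congr (RtoC (exp _)); rewrite /ftrace -[LHS]Ropp_involutive; congr Ropp.
rewrite -[LHS]Rmult_1_l Ropp_mult_distr_r_reverse -Ropp_mult_distr_l_reverse -rsumM.
apply: eq_bigr => i _; rewrite /neg_ln; case: Rle_dec => /= [_|]; first lra.
by have := sp i; lra.
Qed.

(** The logarithm of the determinant grows at rate at least [/ M ^ 3] times the energy. Were the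
    energy zero at some time, the gap would make [c] scalar there, and backward uniqueness would
    make [c0] scalar. *)
Lemma det_increasing : c0 <> (mean c0)%:M ->
  forall s t, (t0 <= s)%R -> (s < t)%R -> (Re (\det (c s)) < Re (\det (c t)))%R.
Proof.
move=> ns s t ss st; have M0 := trace_gt0.
rewrite !det_clamped; try lra; apply: exp_increasing.
pose F s := (- ftrace (neg_ln lo) (c s))%R.
have Fd r : (t0 <= r)%R -> exists2 l, is_derive F r l & (0 < l)%R.
  move=> rr; have [hU E] := diagonalizationP (hc r); move: hU E.
  move: (diagonalization (c r)) => [U d] /= hU E.
  have sp := clamped_spectrum rr hU E.
  have fd := @ftrace_derive (neg_ln lo) (fun a => - / Rmax a lo)%R (/ lo ^ 2) r U d
    (fun a b => neg_ln_convex a b lo0) (fun a b => neg_ln_lipschitz a b lo0) rr hU E.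
  set D := (- ip _ _)%R in fd; exists (- D)%R; first exact: (is_derive_opp (fun s => ftrace (neg_ln lo) (c s))).
  have : (/ M ^ 3 * energy x y (c r) <= - D)%R.
    rewrite /D E Ropp_involutive; apply: ip_lap => // i j.
    rewrite !Rmax_left; try (by have := sp i; lra); try (by have := sp j; lra).
    by apply: inv_coercive; [have := sp i; lra | have := sp j; lra].
  suff : (0 < / M ^ 3 * energy x y (c r))%R by lra.
  apply: Rmult_lt_0_compat; first by apply: Rinv_0_lt_compat; apply: pow_lt.
  apply: Rnot_le_lt => en0; apply: ns; rewrite -{1}ct0.
  apply: (scalar_propagates rr _ (Rle_refl t0)); apply/eqP; rewrite -subr_eq0; apply/eqP.
  apply: hs2_eq0; apply: Rle_trans (gap_at rr) _; nra.
apply: (@derive_gt0_incr F (Derive F) t0 _ _ s t ss st) => r rr;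
  have [l Fl l0] := Fd r rr; rewrite (is_derive_unique _ _ _ Fl) //.
Qed.
End Solution.

(** The spectral bounds hold for every solution, since the logarithm is ordered like the
    eigenvalues; uniqueness thus reduces to the truncated equation. *)
Lemma solution_clamped c : ricci_solution x y t0 c0 c ->
  exists2 c', forall t, (t0 <= t)%R -> c' t = c t & clamped_flow x y lo M t0 c'.
Proof.
move=> sol; have [ct0 _] := sol.
have [c' E [hc' cd]] := ricci_solution_extend hx hy sol; exists c' => //.
have cd' t : (t0 <= t)%R -> exists U d e,
  [/\ is_unitary U, c' t = spect U d, forall i j, (0 <= (d i - d j) * (e i - e j))%R &
      mderiv c' t (- lap x y (spect U e))].
  move=> tt; have [U [d [hU Et dp D]]] := cd t tt.
  exists U, d, (fun i => ln (d i)); split=> // i j; exact: ln_nondecr.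
split=> // t tt; have [U [d [hU Et dp D]]] := cd t tt.
have ct0' : c' t0 = c0 by rewrite E ?ct0 //; exact: Rle_refl.
have sp := flow_spectrum hx hy hc' cd' hU0 ct0' lo0 lod tt hU Et.
rewrite /clamped_field Et (fcalcE _ _ hU).
have -> : (fun i => clamp_ln lo M (d i)) = (fun i => ln (d i)).
  apply: functional_extensionality => i; rewrite /clamp_ln clamp_id //.
  by have := sp i; rewrite ct0' mxtrace_spect.
exact: D.
Qed.
End RicciFlow.

Theorem theorem3p2 (n m : nat) (hn : (1 < n)%N) (hm0 : (0 < m)%N) (hmn : (m < n)%N)
    (hcop : coprime m n)
    (x y : 'M[cpx]_n) (hx : is_hermitian x) (hy : is_hermitian y)
    (hu : is_mexp (two_pi_i_over n *: x) (umat n m))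
    (hv : is_mexp (two_pi_i_over n *: y) (vmat n))
    (t0 : R) (c0 : 'M[cpx]_n) (hc0 : strictly_pos c0) :
  exists c : R -> 'M[cpx]_n,
    ricci_solution x y t0 c0 c /\
    (forall c' : R -> 'M[cpx]_n, ricci_solution x y t0 c0 c' ->
       forall t, Rle t0 t -> c' t = c t) /\
    (forall t, Rle t0 t -> \tr (c t) = \tr c0) /\
    mat_lim_infty c ((c_infty c0)%:M) /\
    (c0 <> (c_infty c0)%:M ->
       (forall t, Rle t0 t -> Im (\det (c t)) = R0) /\
       (forall s t, Rle t0 s -> Rlt s t -> Rlt (Re (\det (c s))) (Re (\det (c t))))) /\
    (c0 = (c_infty c0)%:M -> forall t, Rle t0 t -> c t = c0).
Proof.
have n0 : (0 < n)%N by exact: ltnW.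
have [hU0 E0] := diagonalizationP (proj1 hc0).
move: hU0 E0; move: (diagonalization c0) => [U0 d0] /= hU0 E0.
have d0_gt0 : forall i, Rlt R0 (d0 i) by apply/(strictly_pos_spect _ hU0); rewrite -E0.
(* A positive lower bound for the eigenvalues without taking a minimum: each [/ d0 i] is at most the
   sum of all of them. *)
pose lo := Rinv (\rsum_i / d0 i).
have inv0 i : Rlt 0 (/ d0 i)%R by exact: Rinv_0_lt_compat.
have sum_ge i : Rle (/ d0 i)%R (\rsum_i / d0 i).
  by apply: (rsum_term (F := fun i => (/ d0 i)%R)) => j; have := inv0 j; lra.
have lo0 : Rlt 0 lo.
  by apply: Rinv_0_lt_compat; have := sum_ge (Ordinal n0); have := inv0 (Ordinal n0); lra.
have lod i : Rle lo (d0 i).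
  by rewrite -[d0 i]Rinv_inv; apply: Rinv_le_contravar.
have [C C0 gap] := spectral_gap n0 hcop hu hv.
rewrite -[c_infty c0]/(mean c0) {hc0}; subst c0.
have [c ct0 cflow] := clamped_flow_exists hx hy lo0 (lo_le_trace n0 lo0 lod) t0 (hermitian_spect U0 d0).
exists c; split; first exact: clamped_ricci_solution ct0 cflow.
split=> [c' sol t tt|].
  have [c1 c1E c1flow] := solution_clamped hx hy hU0 lo0 lod sol.
  have c1t0 : c1 t0 = c t0 by rewrite (c1E _ (Rle_refl t0)) ct0; exact: (proj1 sol).
  rewrite -c1E //.
  exact: (clamped_flow_unique lo0 (lo_le_trace n0 lo0 lod) c1flow cflow (Rle_refl t0) c1t0 tt).
split; first by exact: (clamped_trace n0 lo0 lod ct0 cflow).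
split; first exact: (convergence n0 hx hy hU0 lo0 lod ct0 cflow C0 gap).
split=> [ns|sc t tt].
  split=> [t tt|]; last exact: (det_increasing n0 hx hy hU0 lo0 lod ct0 cflow C0 gap ns).
  by rewrite (det_clamped n0 hx hy hU0 lo0 lod ct0 cflow tt).
(* A scalar initial matrix agrees with the constant flow already at [t0]. *)
rewrite sc; apply: (scalar_propagates n0 hU0 lo0 lod cflow (Rle_refl t0) _ tt).
by rewrite ct0 -sc.
Qed.
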